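(* Let $a,b$ be integers with $1\le b\le a$, let $(G_n)_{n\ge0}$ be given by $G_0=1$, $G_1=a+1$, $G_{n+2}=aG_{n+1}+bG_n$ $(n\ge 0)$, and let $\alpha=\frac{a+\sqrt{a^2+4b}}{2}$. Let $f:\mathbb N\to\mathbb R$ be a real-valued $G$-additive function, and for $n\ge1$ put $$D_n=\alpha\sum_{1\le k<a}f(kG_n)+\sum_{1\le k<b}f(kG_{n-1})+b\,f(aG_n).$$ Then $f$ has a limiting distribution if and only if the two series $$\sum_{n\ge1}D_n\qquad\text{and}\qquad \sum_{n\ge0}\ \sum_{1\le k\le a}f(kG_n)^2$$ both converge (the first one not necessarily absolutely). In this case, if $\Phi$ denotes the characteristic function of the limiting distribution and $H_n(t)=\sum_{0\le m<G_n}e^{itf(m)}$, then there exists $t_0>0$ such that $H_n(t)\neq0$ for every $n\ge0$ and every real $t$ with $|t|\le t_0$, and for such $t$ $$\Phi(t)=\frac1\kappa\prod_{n\ge1}\frac{r_n(t)}{\alpha},\qquad r_n(t)=\frac{H_n(t)}{H_{n-1}(t)},$$ where $\kappa=\frac{a+2+\sqrt{a^2+4b}}{2\sqrt{a^2+4b}}$ (so that $G_n/\alpha^n\to\kappa$), and the infinite product is the limit of its partial products.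
   Context: $\mathbb N=\{0,1,2,\dots\}$. Every $n\in\mathbb N$ has a unique (greedy) expansion $n=\sum_{j\ge0}e_j(n)G_j$ with finitely many non-zero digits satisfying $0\le e_j(n)\le a$ and the admissibility rule: $e_{j+1}(n)=a$ implies $e_j(n)<b$. A function $f:\mathbb N\to\mathbb R$ is called $G$-additive if $f(0)=0$ and $f(n)=\sum_{j\ge0}f(e_j(n)G_j)$ for all $n\ge1$. For $N\ge1$ and $x\in\mathbb R$ let $F_N(x)=\frac1N\#\{0\le n<N: f(n)\le x\}$. The function $f$ has a limiting distribution if there is a (probability) distribution function $F$ with $F_N(x)\to F(x)$ at every continuity point $x$ of $F$; its characteristic function is $\Phi(t)=\int e^{itx}\,dF(x)$. *)

(* Defs.v *)
From mathcomp Require Import all_boot all_order all_algebra.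
From mathcomp Require Import all_classical all_reals all_analysis.
From mathcomp.real_closed Require Import complex.

Set Implicit Arguments.
Unset Strict Implicit.
Unset Printing Implicit Defensive.

Import Order.TTheory GRing.Theory Num.Theory.
Import numFieldNormedType.Exports.

Local Open Scope classical_set_scope.
Local Open Scope ring_scope.
Local Open Scope complex_scope.

Fixpoint G (a b n : nat) {struct n} : nat :=
  match n with
  | 0 => 1
  | 1 => a.+1
  | (m.+1 as p).+1 => (a * G a b p + b * G a b m)%N
  end.

(* Greedy division by [G (k-1)], ..., [G 0]; meaningful when [n < G k]. *)
Fixpoint greedy_digit (a b k n j : nat) {struct k} : nat :=
  if k is l.+1 then
    if j == l then (n %/ G a b l)%N else greedy_digit a b l (n %% G a b l)%N j
  else 0%N.

(* Starting at level [n] is enough because [n < G n] (lemma [ltn_G]); in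
   particular [digit a b n j = 0] for [n <= j].  The lemmas [digit_sum],
   [digit_le], [digit_adm] and [digit_uniq] state that these digits form the
   unique admissible expansion of [n]. *)
Definition digit (a b n j : nat) : nat := greedy_digit a b n n j.

Section Digits.
Variables (a b : nat).
Hypotheses (b_gt0 : (0 < b)%N) (le_ba : (b <= a)%N).
Local Open Scope nat_scope.
Local Notation G := (G a b).
Local Notation greedy := (greedy_digit a b).

Lemma GSS n : G n.+2 = a * G n.+1 + b * G n. Proof. by []. Qed.

Lemma G_gt0 n : 0 < G n.
Proof.
suff: 0 < G n /\ 0 < G n.+1 by case.
elim: n => [//|n [h1 h2]]; split => //; rewrite GSS.
by rewrite addn_gt0 !muln_gt0 h2 h1 b_gt0 orbT.
Qed.

Lemma leq_aG n : a * G n <= G n.+1.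
Proof. by case: n => [|n]; [rewrite /= muln1 | rewrite GSS leq_addr]. Qed.

Lemma ltn_GS n : G n < G n.+1.
Proof.
case: n => [|n]; first by rewrite /= ltnS (leq_trans b_gt0).
rewrite GSS -[X in X < _]addn0 -addnS leq_add //.
  by rewrite leq_pmull // (leq_trans b_gt0).
by rewrite muln_gt0 b_gt0 G_gt0.
Qed.

Lemma leq_GS n : G n.+1 <= a.+1 * G n.
Proof.
case: n => [|n]; first by rewrite /= muln1.
rewrite GSS mulSn addnC leq_add2r.
by apply: leq_trans (leq_aG n); rewrite leq_mul2r le_ba orbT.
Qed.

Lemma ltn_G n : n < G n.
Proof. by elim: n => [//|n IH]; apply: leq_ltn_trans IH (ltn_GS n). Qed.

Lemma leq_G m n : m <= n -> G m <= G n.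
Proof.
elim: n => [|n IH]; first by rewrite leqn0 => /eqP ->.
rewrite leq_eqVlt => /orP[/eqP -> //|mn].
exact: leq_trans (IH mn) (ltnW (ltn_GS n)).
Qed.

Lemma greedy_sum k n : n < G k -> n = \sum_(j < k) greedy k n j * G j.
Proof.
elim: k n => [|k IH] n; first by rewrite big_ord0; case: n.
move=> _; rewrite big_ord_recr /= eqxx {1}(divn_eq n (G k)) addnC; congr addn.
rewrite {1}(IH (n %% G k)) ?ltn_mod ?G_gt0 //.
by apply: eq_bigr => j _; rewrite ltn_eqF.
Qed.

Lemma greedy_le k n j : n < G k -> greedy k n j <= a.
Proof.
elim: k n => [//|k IH] n nk /=; case: eqP => _.
  by rewrite -ltnS ltn_divLR ?G_gt0 // (leq_trans nk) ?leq_GS.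
by apply: IH; rewrite ltn_mod G_gt0.
Qed.

Lemma greedy_out k n j : k <= j -> greedy k n j = 0.
Proof.
by elim: k n => [//|k IH] n kj /=; rewrite gtn_eqF // IH // ltnW.
Qed.

Lemma greedy_adm k n j : n < G k -> greedy k n j.+1 = a -> greedy k n j < b.
Proof.
elim: k n => [//|k IH] n nk.
rewrite [greedy k.+1 n j.+1]/=; case: (eqVneq j.+1 k) => [jk ha|jk ha].
  subst k => /=; rewrite ltn_eqF // eqxx.
  rewrite ltn_divLR ?G_gt0 //.
  by move: nk; rewrite GSS {1}(divn_eq n (G j.+1)) ha ltn_add2l.
have /= [jk'|jk'] := eqVneq j k; last first.
  by apply: IH => //; rewrite ltn_mod G_gt0.
by exfalso; move: ha b_gt0 le_ba; rewrite jk' greedy_out // => <-; case: (b).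
Qed.

Lemma greedy_uniq k e : (forall j, e j <= a) ->
  (forall j, e j.+1 = a -> e j < b) ->
  \sum_(j < k) e j * G j < G k /\
  forall j, j < k -> greedy k (\sum_(j < k) e j * G j) j = e j.
Proof.
move=> ea eb.
have lt m : \sum_(j < m) e j * G j < G m.
  suff: \sum_(j < m) e j * G j < G m /\ \sum_(j < m.+1) e j * G j < G m.+1.
    by case.
  elim: m => [|m [h1 h2]].
    by rewrite !big_ord_recr !big_ord0 /= muln1 add0n; split; rewrite // ltnS.
  split=> //; move: (ea m.+1); rewrite leq_eqVlt => /orP[/eqP ha|ha].
    rewrite GSS big_ord_recr /= ha -/(G m.+1) addnC ltn_add2l big_ord_recr.
    apply: leq_trans (_ : (e m).+1 * G m <= _).
      by rewrite mulSn ltn_add2r.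
    by rewrite leq_mul2r (eb _ ha) orbT.
  rewrite big_ord_recr; apply: leq_trans (leq_aG m.+1).
  apply: leq_trans (_ : (e m.+1).+1 * G m.+1 <= _).
    by rewrite mulSn ltn_add2r.
  by rewrite leq_mul2r ha orbT.
split=> //; elim: k => [//|k IH] j jk.
rewrite big_ord_recr /= addnC divnMDl ?modnMDl ?G_gt0 //.
rewrite (divn_small (lt k)) addn0 (modn_small (lt k)); case: eqP => [->//|/eqP jk'].
by apply: IH; rewrite ltn_neqAle jk' -ltnS.
Qed.

Lemma digit_sum n : n = \sum_(j < n) digit a b n j * G j.
Proof. exact: greedy_sum (ltn_G n). Qed.

Lemma digit_le n j : digit a b n j <= a.
Proof. exact: greedy_le (ltn_G n). Qed.

Lemma digit_adm n j : digit a b n j.+1 = a -> digit a b n j < b.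
Proof. exact: greedy_adm (ltn_G n). Qed.

Lemma digit_uniq n K e : (forall j, e j <= a) ->
  (forall j, e j.+1 = a -> e j < b) -> (forall j, K <= j -> e j = 0) ->
  n = \sum_(j < K) e j * G j -> forall j, digit a b n j = e j.
Proof.
move=> ea eb eK nE.
have e0 j : n <= j -> e j = 0.
  move=> nj; case: (ltnP j K) => [jK|/eK//]; apply/eqP; rewrite -leqn0 leqNgt.
  apply/negP => ej; suff: G j <= n.
    by rewrite leqNgt (leq_ltn_trans nj (ltn_G j)).
  rewrite nE (bigD1 (Ordinal jK)) //= (leq_trans _ (leq_addr _ _)) //.
  by rewrite leq_pmull.
have cut p q : p <= q -> (forall j, p <= j -> e j = 0) ->
    \sum_(j < q) e j * G j = \sum_(j < p) e j * G j.
  move=> pq z; rewrite -(subnKC pq) big_split_ord /= [X in _ + X]big1 ?addn0 //.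
  by move=> i _; rewrite z ?leq_addr.
have nE' : n = \sum_(j < n) e j * G j.
  by rewrite -(cut n (maxn n K)) ?leq_maxl // (cut K) ?leq_maxr.
move=> j; case: (ltnP j n) => [jn|nj].
  by rewrite /digit -((greedy_uniq n ea eb).2 j jn) -nE'.
by rewrite e0 // /digit greedy_out.
Qed.

End Digits.

Section GAdditive.
Variables (R : realType) (a b : nat) (f : nat -> R).

Definition G_additive : Prop :=
  f 0%N = 0 /\
  forall n : nat, (0 < n)%N ->
    f n = \sum_(j < n) f (digit a b n j * G a b j)%N.

Definition alpha : R := (a%:R + Num.sqrt (a%:R ^+ 2 + 4 * b%:R)) / 2.

Definition kappa : R :=
  (a%:R + 2 + Num.sqrt (a%:R ^+ 2 + 4 * b%:R))
    / (2 * Num.sqrt (a%:R ^+ 2 + 4 * b%:R)).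

(* Only used for [0 < n]. *)
Definition D (n : nat) : R :=
  alpha * (\sum_(1 <= k < a) f (k * G a b n)%N)
  + \sum_(1 <= k < b) f (k * G a b n.-1)%N
  + b%:R * f (a * G a b n)%N.

(* Only used for [0 < N]. *)
Definition empirical_cdf (N : nat) (x : R) : R :=
  #|[pred n : 'I_N | f n <= x]|%:R / N%:R.

(* [cumulativeBounded 0 1]: nondecreasing, right-continuous, with limit 0 at
   -oo and 1 at +oo, that is, a probability distribution function. *)
Definition limiting_distribution (F : cumulativeBounded (0 : R) (1 : R))
    : Prop :=
  forall x : R, {for x, continuous F} ->
    empirical_cdf N x @[N --> \oo] --> F x.

Definition has_limiting_distribution : Prop :=
  exists F : cumulativeBounded (0 : R) (1 : R), limiting_distribution F.

Definition expi (x : R) : R[i] := cos x +i* sin x.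

Definition H (n : nat) (t : R) : R[i] :=
  \sum_(m < G a b n) expi (t * f m).

(* Only used for [0 < n]. *)
Definition r (n : nat) (t : R) : R[i] := H n t / H n.-1 t.

End GAdditive.

(* [\int e^(itx) dF(x)], the integral of a complex function being taken
   componentwise. *)
Definition char_fun (R : realType) (F : cumulativeBounded (0 : R) (1 : R))
    (t : R) : R[i] :=
  (\int[lebesgue_stieltjes_measure F]_x cos (t * x))%R
  +i* (\int[lebesgue_stieltjes_measure F]_x sin (t * x))%R.

(* Main.v *)
(** Everything rests on second moments over the blocks [0, G_n).  Such a block
    splits into [a] shifted copies of [0, G_(n-1)) and [b] shifted copies of
    [0, G_(n-2)), so the means mu_n and the variances of f over the blocks obey
    linear recurrences.  The variance is at most a constant times
    sum_j sum_k f(k G_j)^2, while mu_n equals a contraction applied to the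
    partial sums of the D_j, up to an absolutely summable error.

    Sufficiency: cutting off the digits of index < K leaves an additive function
    whose mean square over [0, N) tends to 0 as K grows, uniformly in N, whereas
    the cut-off part takes finitely many values, each with a limiting frequency.
    By Chebyshev the empirical distribution functions form a Cauchy sequence for
    the Levy distance, and their limit is built directly.

    Necessity: for a small fixed t, |H_n(t)| is comparable to alpha^n.  H_(n+2)
    is a sum of [a] rotated copies of H_(n+1) and [b] of H_n, and the total loss
    in the triangle inequality is summable; hence all phases involved, among them
    the exp(i t f(k G_n)), are square summably close to 1.  Once the quadratic
    series converges, exp(-i t mu_n) H_n(t) / G_n converges by the same
    truncation as above, so mu_n converges and with it the series of the D_n.

    The product formula telescopes to H_N(t) / alpha^N. *)

From HB Require Import structures.
Require Import Defs.
From mathcomp Require Import all_boot all_order all_algebra.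
From mathcomp Require Import all_classical all_reals all_analysis.
From mathcomp.real_closed Require Import complex.
From mathcomp Require Import ring lra.

Set Implicit Arguments.
Unset Strict Implicit.
Unset Printing Implicit Defensive.

Import Order.TTheory GRing.Theory Num.Theory.
Import numFieldNormedType.Exports.

Local Open Scope classical_set_scope.
Local Open Scope ring_scope.
Local Open Scope complex_scope.

(** The first series may converge only conditionally, so f is split into a mean and a fluctuation:
    the fluctuation costs only the squares f(kG_j)^2, and all cancellation is left to the means. The
    shape of D_n comes from the recurrence of the block sums. Its inhomogeneous term becomes G_(n-1)
    D_n when the ratio G_n / G_(n-1) is replaced by its limit alpha; the second root beta satisfies
    |beta| <= alpha / 2, so the replacement costs a geometrically small factor, harmless once the
    values f(kG_j) are bounded. In the converse direction the starting information is tightness of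
    the values of f. It bounds the f(kG_n), and for small t it keeps |H_n(t)| above G_n / 2, so that
    phases are meaningful. A phase exp(-itmu_n) determines mu_n only modulo 2pi/t; hence the mu_n
    are first shown to be bounded, from tightness and the variance bound, and t is then chosen small
    against that bound. Convergence of distribution functions is passed to averages of cos(tf) and
    sin(tf) by Riemann-Stieltjes sums over continuity points of F. *)

Local Notation normc := ComplexField.Normc.normc.

(** * Digits and blocks *)

Section Blocks.
Variables (a b : nat).
Hypotheses (b_gt0 : (0 < b)%N) (le_ba : (b <= a)%N).
Local Notation G := (Defs.G a b).

Lemma digit_greedy K n j : (n < G K)%N ->
  digit a b n j = greedy_digit a b K n j.
Proof.
move=> nK; apply: (digit_uniq b_gt0 le_ba (K := K)).
- by move=> i; apply: greedy_le.
- by move=> i; apply: greedy_adm.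
- by move=> i; apply: greedy_out.
- exact: greedy_sum.
Qed.

Lemma digit_out K n j : (n < G K)%N -> (K <= j)%N -> digit a b n j = 0%N.
Proof. by move=> nK Kj; rewrite (digit_greedy _ nK) greedy_out. Qed.

Lemma digit_block n k m j : (m < G n)%N -> (k * G n + m < G n.+1)%N ->
  digit a b (k * G n + m) j = if j == n then k else digit a b m j.
Proof.
move=> mn kn; rewrite (digit_greedy _ kn) [LHS]/= -/(G n).
rewrite divnMDl ?G_gt0 // modnMDl divn_small // modn_small // addn0.
by rewrite (digit_greedy _ mn).
Qed.

Lemma ltn_aG n : (a * G n < G n.+1)%N.
Proof.
case: n => [|n]; first by rewrite muln1.
by rewrite GSS -[X in (X < _)%N]addn0 ltn_add2l muln_gt0 b_gt0 G_gt0.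
Qed.

Lemma ltn_kG n k : (k <= a)%N -> (k * G n < G n.+1)%N.
Proof.
by move=> ka; apply: leq_ltn_trans (ltn_aG n); rewrite leq_mul2r ka orbT.
Qed.

Lemma ltn_block n k m : (k < a)%N -> (m < G n)%N -> (k * G n + m < G n.+1)%N.
Proof.
move=> ka mn; apply: leq_trans (leq_aG a b n).
apply: leq_trans (_ : (k.+1 * G n <= _)%N); last by rewrite leq_mul2r ka orbT.
by rewrite mulSn addnC ltn_add2r.
Qed.

Lemma ltn_topblock n k m : (k < b)%N -> (m < G n)%N ->
  (a * G n.+1 + (k * G n + m) < G n.+2)%N.
Proof.
move=> kb mn; rewrite GSS ltn_add2l.
apply: leq_trans (_ : (k.+1 * G n <= _)%N); last by rewrite leq_mul2r kb orbT.
by rewrite mulSn addnC ltn_add2r.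
Qed.

Lemma sum_blocks (V : nmodType) (phi : nat -> V) p q :
  \sum_(m < p * q) phi m = \sum_(k < p) \sum_(m < q) phi (k * q + m)%N.
Proof.
elim: p => [|p IH]; first by rewrite mul0n !big_ord0.
rewrite mulSnr big_split_ord /= IH big_ord_recr /=.
by congr (_ + _); apply: eq_bigr => i _.
Qed.

Lemma sum_GSS (V : nmodType) (phi : nat -> V) n :
  \sum_(m < G n.+2) phi m =
  \sum_(k < a) \sum_(m < G n.+1) phi (k * G n.+1 + m)%N +
  \sum_(k < b) \sum_(m < G n) phi (a * G n.+1 + (k * G n + m))%N.
Proof.
rewrite GSS big_split_ord /= sum_blocks; congr (_ + _).
by rewrite (sum_blocks (fun m => phi (a * G n.+1 + m)%N)).
Qed.

(** Additivity in the form used by the block recurrences: a leading digit splits off. It passes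
    directly from [f] and [truncate_low f K] to their difference. The guard [k * G n + m < G n.+1]
    admits k = a as long as m stays in the incomplete last subblock. *)
Definition block_additive (V : zmodType) (g : nat -> V) :=
  forall n k m, (m < G n)%N -> (k * G n + m < G n.+1)%N ->
  g (k * G n + m)%N = g (k * G n)%N + g m.

Lemma block_additive0 (V : zmodType) (g : nat -> V) : block_additive g ->
  g 0%N = 0.
Proof.
move=> gB; have := gB 0%N 0%N 0%N isT isT.
by rewrite mul0n addn0 => /(congr1 (fun x => x - g 0%N)); rewrite subrr addrK.
Qed.

Lemma sum_GSS_additive (V : zmodType) (W : nmodType) (g : nat -> V) (psi : V -> W) n :
  block_additive g ->
  \sum_(m < G n.+2) psi (g m) =
  \sum_(k < a) \sum_(m < G n.+1) psi (g (k * G n.+1)%N + g m) +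
  \sum_(k < b) \sum_(m < G n)
     psi (g (a * G n.+1)%N + (g (k * G n)%N + g m)).
Proof.
move=> gB; rewrite (sum_GSS (fun m => psi (g m))); congr (_ + _).
  by apply: eq_bigr => k _; apply: eq_bigr => m _; rewrite gB // ltn_block.
apply: eq_bigr => k _; apply: eq_bigr => m _.
have ka : (k < a)%N := leq_trans (ltn_ord k) le_ba.
by rewrite gB ?ltn_topblock ?ltn_block // gB ?ltn_block.
Qed.

Definition truncate_low (V : zmodType) (g : nat -> V) (K n : nat) : V :=
  \sum_(j < K) g (digit a b n j * G j)%N.

Lemma additive_truncate (V : zmodType) (g : nat -> V) K : g 0%N = 0 ->
  block_additive (truncate_low g K).
Proof.
move=> g0 n k m mn kmn; rewrite /truncate_low -big_split /=.
have kn : (k * G n + 0 < G n.+1)%N.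
  by rewrite addn0 (leq_ltn_trans _ kmn) // leq_addr.
apply: eq_bigr => j _; rewrite digit_block //.
rewrite -[in X in _ = g (digit _ _ X _ * _)%N + _](addn0 (k * G n)%N).
rewrite digit_block ?G_gt0 //; case: eqP => [->|_].
  by rewrite (digit_out mn) // mul0n g0 addr0.
by rewrite (digit_out (K := 0) (n := 0)) // mul0n g0 add0r.
Qed.

Lemma truncate_high (V : zmodType) (g : nat -> V) K n k m : g 0%N = 0 ->
  (K <= n)%N -> (m < G n)%N -> (k * G n + m < G n.+1)%N ->
  truncate_low g K (k * G n + m) = truncate_low g K m.
Proof.
move=> g0 Kn mn kmn; apply: eq_bigr => j _; rewrite digit_block //.
by rewrite ltn_eqF // (leq_trans (ltn_ord j)).
Qed.

Lemma truncate_kG (V : zmodType) (g : nat -> V) K n k : g 0%N = 0 ->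
  (k <= a)%N ->
  truncate_low g K (k * G n) = if (n < K)%N then g (k * G n)%N else 0.
Proof.
move=> g0 ka.
have kn : (k * G n + 0 < G n.+1)%N by rewrite addn0 ltn_kG.
have dE j : digit a b (k * G n) j = if j == n then k else 0%N.
  by rewrite -[(k * G n)%N]addn0 digit_block ?G_gt0 // (digit_out (K := 0) (n := 0)).
rewrite /truncate_low; case: ltnP => nK.
  rewrite (bigD1 (Ordinal nK)) //= dE eqxx big1 ?addr0 // => j jn.
  by rewrite dE (negPf (jn : (j : nat) != n)) mul0n.
by rewrite big1 // => j _; rewrite dE ltn_eqF ?mul0n // (leq_trans (ltn_ord j)).
Qed.

Lemma G_additive_truncate (R : realType) (f : nat -> R) K n :
  G_additive a b f -> (n < G K)%N -> f n = truncate_low f K n.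
Proof.
case=> f0 fA nK; have cut p : (n < G p)%N -> (forall q, (p <= q)%N ->
    truncate_low f q n = truncate_low f p n).
  move=> np q pq; rewrite /truncate_low -(subnKC pq) big_split_ord /=.
  rewrite [X in _ + X]big1 ?addr0 // => j _.
  by rewrite (digit_out np) ?leq_addr // mul0n.
have -> : f n = truncate_low f n n.
  case: (posnP n) => [-> |]; last exact: fA.
  by rewrite f0 /truncate_low big_ord0.
have nn := ltn_G b_gt0 le_ba n.
by rewrite -(cut n nn (maxn n K)) ?leq_maxl // (cut K) ?leq_maxr.
Qed.

Lemma G_additive_block (R : realType) (f : nat -> R) :
  G_additive a b f -> block_additive f.
Proof.
move=> fA n k m mn kmn.
have mn1 : (m < G n.+1)%N by rewrite (leq_ltn_trans _ kmn) // leq_addl.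
have kn1 : (k * G n < G n.+1)%N by rewrite (leq_ltn_trans _ kmn) // leq_addr.
rewrite !(G_additive_truncate (K := n.+1) fA) //.
by apply: additive_truncate => //; case: fA.
Qed.

Lemma additive_tail (V : zmodType) (f : nat -> V) K :
  block_additive f -> block_additive (fun n => f n - truncate_low f K n).
Proof.
move=> fB n k m mn kmn; rewrite fB // (additive_truncate _ (block_additive0 fB)) //.
by rewrite opprD addrACA.
Qed.

Lemma tail_kG (V : zmodType) (f : nat -> V) K n k : f 0%N = 0 ->
  (k <= a)%N ->
  f (k * G n)%N - truncate_low f K (k * G n) =
  if (n < K)%N then 0 else f (k * G n)%N.
Proof.
by move=> f0 ka; rewrite truncate_kG //; case: ltnP; rewrite ?subrr ?subr0.
Qed.

Lemma G_bracket N : (0 < N)%N -> exists2 J, (G J <= N)%N & (N < G J.+1)%N.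
Proof.
move=> N0; have ex : exists J, (N < G J)%N by exists N; apply: ltn_G.
case: (ex_minnP ex) => -[|J] NJ Jmin; first by move: NJ; rewrite ltnS leqn0 (gtn_eqF N0).
by exists J => //; rewrite leqNgt; apply/negP => /Jmin; rewrite ltnn.
Qed.

End Blocks.

(** * Growth of G *)

Section Growth.
Variables (R : realType) (a b : nat).
Hypotheses (b_gt0 : (0 < b)%N) (le_ba : (b <= a)%N).
Local Notation G := (Defs.G a b).
Local Notation al := (alpha R a b).
Local Notation ka := (kappa R a b).
Local Notation s := (Num.sqrt (a%:R ^+ 2 + 4 * b%:R) : R).

(** The conjugate root of x^2 = a x + b, read off from the sum of the roots; it is negative. *)
Definition beta : R := a%:R - al.
Definition rho : R := beta / al.

Let a1 : 1 <= a%:R :> R.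
Proof. by rewrite ler1n (leq_trans b_gt0). Qed.
Let b1 : 1 <= b%:R :> R. Proof. by rewrite ler1n. Qed.
Let ba : b%:R <= a%:R :> R. Proof. by rewrite ler_nat. Qed.

Let s2 : s ^+ 2 = a%:R ^+ 2 + 4 * b%:R.
Proof. by rewrite sqr_sqrtr // addr_ge0 // ?sqr_ge0 // mulr_ge0. Qed.
Let s0 : 0 <= s. Proof. exact: sqrtr_ge0. Qed.
Let alE : al = (a%:R + s) / 2. Proof. by []. Qed.
Let sE : s = 2 * al - a%:R. Proof. by rewrite alE; lra. Qed.

Lemma alpha_root : al ^+ 2 = a%:R * al + b%:R.
Proof. by move: s2; rewrite sE; lra. Qed.

Lemma alpha_gea : a%:R <= al.
Proof. by rewrite alE; move: s2 s0 a1 b1; nra. Qed.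

Lemma alpha_ge1 : 1 <= al. Proof. exact: le_trans a1 alpha_gea. Qed.
Lemma alpha_gt0 : 0 < al. Proof. exact: lt_le_trans ltr01 alpha_ge1. Qed.

Lemma alpha_lea1 : al <= a%:R + 1.
Proof. by rewrite alE; move: s2 s0 a1 b1 ba; nra. Qed.

Lemma alphaM_beta : al * beta = - b%:R.
Proof. by rewrite /beta mulrBr -expr2 alpha_root; ring. Qed.

Lemma rho_norm : `|rho| <= 1 / 2.
Proof.
rewrite /rho normrM normfV (gtr0_norm alpha_gt0) ler_pdivrMr ?alpha_gt0 //.
rewrite /beta distrC ger0_norm ?subr_ge0 ?alpha_gea //.
by move: alpha_lea1 a1; lra.
Qed.

Lemma GS_alpha n : (G n.+1)%:R = al * (G n)%:R + beta ^+ n * (a%:R + 1 - al) :> R.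
Proof.
elim: n => [|n IH]; first by rewrite /= expr0 natr1 !mulr1 mul1r; ring.
have bE : b%:R = - (al * beta) by rewrite alphaM_beta opprK.
have aE : a%:R = al + beta by rewrite /beta; ring.
rewrite GSS natrD !natrM bE IH exprS [X in X * (_ + _)]aE; ring.
Qed.

Lemma kappa_gt0 : 0 < ka.
Proof.
have s1 : 0 < s by rewrite sE; move: alpha_gea a1; lra.
by rewrite /kappa divr_gt0 ?mulr_gt0 //; move: a1; lra.
Qed.

(** The Binet formula. Multiplying by s = alpha - beta clears the denominator of kappa, after which
    [GS_alpha] gives the induction step. *)
Lemma G_closed n : (G n)%:R = al ^+ n * (ka + (1 - ka) * rho ^+ n) :> R.
Proof.
have al0 : al != 0 by rewrite gt_eqF ?alpha_gt0.
have s1 : 0 < s by rewrite sE; move: alpha_gea a1; lra.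
have kE : ka * s = a%:R + 1 - beta.
  rewrite /kappa /beta sE; field.
  by move: s1; rewrite sE => s1; rewrite gt_eqF.
have sE' : s = al - beta by rewrite sE /beta; ring.
have bE : al ^+ n * rho ^+ n = beta ^+ n by rewrite -exprMn mulrC divfK.
rewrite mulrDr (mulrCA _ (1 - ka)) bE.
have : s * (G n)%:R = s * (al ^+ n * ka + (1 - ka) * beta ^+ n).
  rewrite mulrDr (mulrCA s _ ka) [s * ka]mulrC kE (mulrA s (1 - ka)).
  rewrite (mulrBr s 1 ka) mulr1 [s * ka]mulrC kE sE'.
  elim: n {bE} => [|n IH]; first by rewrite !expr0 [G 0]/=; ring.
  rewrite GS_alpha mulrDr [_ * (al * _)]mulrCA IH !exprS; ring.
exact: (mulfI (lt0r_neq0 s1)).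
Qed.

Lemma expr_rho_norm n : `|rho ^+ n| <= (1 / 2) ^+ n.
Proof. by rewrite normrX lerXn2r ?nnegrE ?normr_ge0 ?rho_norm. Qed.

Lemma rho_cvg0 : rho ^+ n @[n --> \oo] --> (0 : R).
Proof. apply: cvg_expr; apply: le_lt_trans rho_norm _; lra. Qed.

Lemma G_alpha_cvg : (G n)%:R / al ^+ n @[n --> \oo] --> ka.
Proof.
have -> : (fun n => (G n)%:R / al ^+ n) = (fun n => ka + (1 - ka) * rho ^+ n).
  apply/funext => n; rewrite G_closed mulrAC divff ?mul1r //.
  by rewrite expf_neq0 // gt_eqF ?alpha_gt0.
suff : (fun n => ka + (1 - ka) * rho ^+ n) n @[n --> \oo] --> ka + (1 - ka) * 0.
  by rewrite mulr0 addr0.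
by apply: cvgD; [exact: cvg_cst|apply: cvgMr; exact: rho_cvg0].
Qed.

Lemma alpha_SS n : al ^+ n.+2 = a%:R * al ^+ n.+1 + b%:R * al ^+ n.
Proof. by rewrite !exprS mulrA -expr2 alpha_root; ring. Qed.

Lemma G_gealpha n : al ^+ n <= (G n)%:R.
Proof.
suff: al ^+ n <= (G n)%:R /\ al ^+ n.+1 <= (G n.+1)%:R by case.
elim: n => [|n [h1 h2]].
  by rewrite expr0 expr1 [G 0]/= [G 1]/= -(natr1 a) alpha_lea1.
split=> //; by rewrite GSS natrD !natrM alpha_SS lerD // ler_wpM2l.
Qed.

Lemma G_lealpha n : (G n)%:R <= 2 * al ^+ n.
Proof.
suff: (G n)%:R <= 2 * al ^+ n /\ (G n.+1)%:R <= 2 * al ^+ n.+1 by case.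
elim: n => [|n [h1 h2]].
  by rewrite expr0 expr1 [G 0]/= [G 1]/= -(natr1 a); move: alpha_gea a1; split; lra.
split=> //; rewrite GSS natrD !natrM alpha_SS mulrDr.
by rewrite lerD // mulrCA ler_wpM2l.
Qed.

Lemma G_ge1 n : 1 <= (G n)%:R :> R.
Proof. by rewrite ler1n G_gt0. Qed.

Lemma Gr_gt0 n : 0 < (G n)%:R :> R.
Proof. by rewrite ltr0n G_gt0. Qed.

Lemma Gr_SS n : (G n.+2)%:R = a%:R * (G n.+1)%:R + b%:R * (G n)%:R :> R.
Proof. by rewrite GSS natrD !natrM. Qed.

(** Source of the contraction factor 1/2 for increments of block means: G_(n+2) also contains a
    G_(n+1), which is at least b G_n. *)
Lemma Gr_half n : b%:R * (G n)%:R <= 1 / 2 * (G n.+2)%:R :> R.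
Proof.
rewrite Gr_SS; have : (G n)%:R <= (G n.+1)%:R :> R.
  by rewrite ler_nat ltnW // ltn_GS.
by move: ba b1 (G_ge1 n); nra.
Qed.

End Growth.

(** * Mean and variance over a block *)

Local Arguments Defs.G : simpl never.

Lemma sum_constr (R : pzRingType) n (c : R) : \sum_(i < n) c = n%:R * c.
Proof. by rewrite sumr_const card_ord mulr_natl. Qed.

Section Moments.
Variables (R : realType) (a b : nat).
Hypotheses (b_gt0 : (0 < b)%N) (le_ba : (b <= a)%N).
Local Notation G := (Defs.G a b).
Variable g : nat -> R.
Hypothesis gB : block_additive a b g.

Definition digit_energy n := \sum_(1 <= k < a.+1) g (k * G n)%N ^+ 2.
Definition block_sum n := \sum_(m < G n) g m.
Definition block_mean n := block_sum n / (G n)%:R.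
(** Not divided by [G n], so that its recurrence has the coefficients a and b of the recurrence of
    [G]. *)
Definition block_var n := \sum_(m < G n) (g m - block_mean n) ^+ 2.
Local Notation q := digit_energy.
Local Notation M := block_sum.
Local Notation mu := block_mean.
Local Notation V := block_var.

Let Ggt0 := @Gr_gt0 R a b b_gt0.
Let g0 : g 0%N = 0 := block_additive0 gB.
Let a_gt0 : (0 < a)%N := leq_trans b_gt0 le_ba.

Lemma digit_energy_ge0 n : 0 <= q n.
Proof. by apply: sumr_ge0 => k _; exact: sqr_ge0. Qed.

Lemma digit_sq_le n k : (k <= a)%N -> g (k * G n)%N ^+ 2 <= q n.
Proof.
case: k => [|k] ka; first by rewrite mul0n g0 expr0n /= digit_energy_ge0.
rewrite /q (bigD1_seq k.+1) ?mem_index_iota ?iota_uniq //=.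
by rewrite lerDl sumr_ge0 // => i _; exact: sqr_ge0.
Qed.

Lemma digit_norm_le n k : (k <= a)%N -> `|g (k * G n)%N| <= Num.sqrt (q n).
Proof. by move=> ka; rewrite -sqrtr_sqr ler_wsqrtr // digit_sq_le. Qed.

Lemma sum_ord_nat1 (F : nat -> R) p : (0 < p)%N -> F 0%N = 0 ->
  \sum_(k < p) F k = \sum_(1 <= k < p) F k.
Proof. by move=> p0 F0; rewrite -(big_mkord xpredT F) big_ltn // F0 add0r. Qed.

Lemma sum_digit_sq n : \sum_(k < a) g (k * G n)%N ^+ 2 <= q n.
Proof.
rewrite (sum_ord_nat1 (F := fun k => g (k * G n)%N ^+ 2)) //; last by rewrite mul0n g0 expr0n.
by rewrite /q big_nat_recr //= lerDl sqr_ge0.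
Qed.

Lemma block_sumSS n : M n.+2 =
  a%:R * M n.+1 + b%:R * M n +
  ((G n.+1)%:R * (\sum_(1 <= k < a) g (k * G n.+1)%N) +
   (G n)%:R * (\sum_(1 <= k < b) g (k * G n)%N + b%:R * g (a * G n.+1)%N)).
Proof.
rewrite /M (sum_GSS_additive le_ba id n gB) /=.
rewrite -(sum_ord_nat1 (F := fun k => g (k * G n.+1)%N)) ?mul0n //.
rewrite -(sum_ord_nat1 (F := fun k => g (k * G n)%N)) ?mul0n //.
under eq_bigr do rewrite big_split /= sum_constr.
rewrite big_split /= sum_constr -mulr_sumr.
under [X in _ + X = _]eq_bigr do rewrite !big_split /= !sum_constr.
rewrite !big_split /= !sum_constr -!mulr_sumr.
by ring.
Qed.

Lemma mulG_mean n : (G n)%:R * mu n = M n.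
Proof. by rewrite mulrC divfK // gt_eqF. Qed.

(** The parallel axis identity, which exchanges second moments about different centres. *)
Lemma sum_sqr_shift n c :
  \sum_(m < G n) (g m + c) ^+ 2 = V n + (G n)%:R * (mu n + c) ^+ 2.
Proof.
have E m : (g m + c) ^+ 2 = (g m - mu n) ^+ 2 + (2 * (mu n + c) * g m +
     ((mu n + c) ^+ 2 - 2 * (mu n + c) * mu n)) by ring.
under eq_bigr do rewrite E.
rewrite !big_split /= !sum_constr -mulr_sumr -/(M n) -/(V n) -mulG_mean.
by ring.
Qed.

Lemma block_var_ge0 n : 0 <= V n.
Proof. by apply: sumr_ge0 => k _; exact: sqr_ge0. Qed.

(* The second moment about [mu n.+1] bounds the variance from above; this centre
   makes the cross terms of the [a] large subblocks vanish. *)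
Lemma block_varSS n : V n.+2 <= a%:R * V n.+1 + b%:R * V n +
  (G n.+2)%:R * (3 * (q n.+1 + q n + (mu n.+1 - mu n) ^+ 2)).
Proof.
set d2 := (mu n.+1 - mu n) ^+ 2.
have d20 : 0 <= d2 by exact: sqr_ge0.
have := sum_sqr_shift n.+2 (- mu n.+1).
rewrite (sum_GSS_additive le_ba (fun x => (x - mu n.+1) ^+ 2) n gB).
have -> : \sum_(k < a) \sum_(m < G n.+1) (g (k * G n.+1)%N + g m - mu n.+1) ^+ 2
   = a%:R * V n.+1 + (G n.+1)%:R * \sum_(k < a) g (k * G n.+1)%N ^+ 2.
  rewrite -(sum_constr a (V n.+1)) [(G n.+1)%:R * _]mulr_sumr -big_split /=.
  apply: eq_bigr => k _.
  under eq_bigr do rewrite addrAC addrC addrA.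
  rewrite (eq_bigr (fun m : 'I__ => (g m + (g (k * G n.+1)%N - mu n.+1)) ^+ 2)).
    by rewrite sum_sqr_shift; congr (_ + _ * _ ^+ 2); ring.
  by move=> m _; congr (_ ^+ 2); ring.
(* In the small subblocks two digit values and the displacement mu_n - mu_(n+1) add up; the 3 is (x
   + y + z)^2 <= 3 (x^2 + y^2 + z^2). *)
have B : \sum_(k < b) \sum_(m < G n)
     (g (a * G n.+1)%N + (g (k * G n)%N + g m) - mu n.+1) ^+ 2
   <= b%:R * (V n + (G n)%:R * (3 * (q n.+1 + q n + d2))).
  rewrite -sum_constr; apply: ler_sum => k _.
  rewrite (eq_bigr (fun m : 'I__ =>
      (g m + (g (a * G n.+1)%N + g (k * G n)%N - mu n.+1)) ^+ 2)); last first.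
    by move=> m _; congr (_ ^+ 2); ring.
  rewrite sum_sqr_shift lerD2l ler_wpM2l ?ler0n //.
  have x1 := digit_sq_le n.+1 (leqnn a).
  have x2 : g (k * G n)%N ^+ 2 <= q n.
    by apply: digit_sq_le; rewrite (leq_trans _ le_ba) // ltnW.
  rewrite /d2; set x := g (a * _)%N in x1 *; set y := g (_ * _)%N in x2 *.
  have h1 := sqr_ge0 (x - y); have h2 := sqr_ge0 (x - (mu n - mu n.+1)).
  have h3 := sqr_ge0 (y - (mu n - mu n.+1)).
  by nra.
have A := sum_digit_sq n.+1.
have q0 := digit_energy_ge0 n; have q1 := digit_energy_ge0 n.+1.
have sq := sqr_ge0 (mu n.+2 - mu n.+1).
have G1 := Ggt0 n.+1; have G0 := Ggt0 n; have G2 := Ggt0 n.+2.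
have a1 : 1 <= a%:R :> R by rewrite ler1n.
have A' : (G n.+1)%:R * (\sum_(k < a) g (k * G n.+1)%N ^+ 2) <=
    a%:R * (G n.+1)%:R * (3 * (q n.+1 + q n + d2)).
  apply: le_trans (_ : (G n.+1)%:R * q n.+1 <= _); first by rewrite ler_wpM2l // ltW.
  by rewrite [a%:R * _]mulrC -mulrA ler_wpM2l ?(ltW G1) //; nra.
move=> E; have H := mulr_ge0 (ltW G2) sq.
have -> : (G n.+2)%:R * (3 * (q n.+1 + q n + d2)) =
    (a%:R * (G n.+1)%:R + b%:R * (G n)%:R) * (3 * (q n.+1 + q n + d2)).
  by rewrite Gr_SS.
by move: B A' E H; lra.
Qed.

Lemma block_meanSS n :
  (G n.+2)%:R * (mu n.+2 - mu n.+1) = - (b%:R * (G n)%:R) * (mu n.+1 - mu n) +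
  ((G n.+1)%:R * (\sum_(1 <= k < a) g (k * G n.+1)%N) +
   (G n)%:R * (\sum_(1 <= k < b) g (k * G n)%N + b%:R * g (a * G n.+1)%N)).
Proof. by rewrite mulrBr mulG_mean block_sumSS -!mulG_mean Gr_SS; ring. Qed.

Lemma sum_norm_le (F : nat -> R) p X : 0 <= X ->
  (forall k, (k < p)%N -> `|F k| <= X) -> `|\sum_(1 <= k < p) F k| <= p%:R * X.
Proof.
move=> X0 FX; apply: le_trans (ler_norm_sum _ _ _) _.
apply: le_trans (_ : \sum_(1 <= k < p) X <= _).
  by rewrite big_nat [leRHS]big_nat; apply: ler_sum => k /andP[_ /FX].
by rewrite sumr_const_nat -[X *+ _]mulr_natl ler_wpM2r // ler_nat leq_subr.
Qed.

(** By [block_meanSS] and [Gr_half] the increment u is at most v/2 + w, with v the previous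
    increment and w = X + Y. Then (v/2 + w)^2 <= v^2/2 + 2 w^2 and w^2 <= 2 (X^2 + Y^2) give the
    constants 1/2 and 4. *)
Lemma block_mean_step n : (mu n.+2 - mu n.+1) ^+ 2 <=
  1 / 2 * (mu n.+1 - mu n) ^+ 2 + 4 * (q n.+1 + q n).
Proof.
set X := Num.sqrt (q n.+1); set Y := Num.sqrt (q n).
have X0 : 0 <= X := sqrtr_ge0 _; have Y0 : 0 <= Y := sqrtr_ge0 _.
have X2 : X ^+ 2 = q n.+1 by rewrite sqr_sqrtr // digit_energy_ge0.
have Y2 : Y ^+ 2 = q n by rewrite sqr_sqrtr // digit_energy_ge0.
have G1 := Ggt0 n.+1; have G0 := Ggt0 n; have G2 := Ggt0 n.+2.
have S1 : `|\sum_(1 <= k < a) g (k * G n.+1)%N| <= a%:R * X.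
  by apply: (sum_norm_le (F := fun k => g (k * _)%N)) => // k /ltnW; exact: digit_norm_le.
have S2 : `|\sum_(1 <= k < b) g (k * G n)%N| <= b%:R * Y.
  apply: (sum_norm_le (F := fun k => g (k * _)%N)) => // k /ltnW kb.
  by apply: digit_norm_le; exact: leq_trans kb le_ba.
have S3 := digit_norm_le n.+1 (leqnn a); rewrite -/X in S3.
have bb : 0 <= b%:R :> R by [].
have aa : 0 <= a%:R :> R by [].
have h := Gr_half R b_gt0 le_ba n.
have D : (G n.+2)%:R * `|mu n.+2 - mu n.+1| <=
    (G n.+2)%:R * (1 / 2 * `|mu n.+1 - mu n| + (X + Y)).
  rewrite -{1}(gtr0_norm G2) -normrM block_meanSS.
  apply: le_trans (ler_normD _ _) _; rewrite (mulrDr (G n.+2)%:R); apply: lerD.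
    rewrite normrM normrN (ger0_norm (mulr_ge0 bb (ltW G0))).
    by have := ler_wpM2r (normr_ge0 (mu n.+1 - mu n)) h; lra.
  apply: le_trans (ler_normD _ _) _; rewrite Gr_SS.
  apply: le_trans (_ : (G n.+1)%:R * (a%:R * X) + (G n)%:R * (b%:R * Y + b%:R * X) <= _).
    rewrite !normrM !normr_nat; apply: lerD; first by rewrite ler_wpM2l.
    rewrite ler_wpM2l //; apply: le_trans (ler_normD _ _) _.
    by apply: lerD => //; rewrite normrM normr_nat ler_wpM2l.
  have := mulr_ge0 (mulr_ge0 aa (ltW G1)) Y0.
  by move: (mulr_ge0 bb (ltW G0)); nra.
rewrite ler_pM2l // in D.
rewrite -X2 -Y2 -[leLHS]real_normK ?num_real // -[X in 1 / 2 * X]real_normK ?num_real //.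
have u0 := normr_ge0 (mu n.+2 - mu n.+1); have v0 := normr_ge0 (mu n.+1 - mu n).
move: D u0 v0; set u := `|mu n.+2 - mu n.+1|; set v := `|mu n.+1 - mu n|.
move=> D u0 v0.
have := sqr_ge0 (1/2 * v - (X + Y)); have := sqr_ge0 (X - Y).
have : u ^+ 2 <= (1 / 2 * v + (X + Y)) ^+ 2.
  have w0 : 0 <= 1 / 2 * v + (X + Y) by lra.
  by rewrite ler_sqr ?nnegrE.
by nra.
Qed.

(* The weight 6 on the squared increment of the mean is chosen so that half of it,
   gained from [block_mean_step], pays for the term 3 of [block_varSS]. *)
Lemma block_var_aux n :
  let P := 7 * q 0 + 27 * \sum_(i < n) (q i.+1 + q i) in
  let d := 6 * (mu n.+1 - mu n) ^+ 2 in
  V n + (G n)%:R * d <= (G n)%:R * P /\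
  V n.+1 + (G n.+1)%:R * d <= (G n.+1)%:R * P.
Proof.
elim: n => [|n /= [IH1 IH2]].
  have mu0 : mu 0 = 0 by rewrite /mu /M big_ord_recl big_ord0 /= g0 addr0 mul0r.
  have V0 : V 0 = 0 by rewrite /V big_ord_recl big_ord0 /= g0 mu0 subr0 addr0 expr0n.
  have E : V 1 + (G 1)%:R * mu 1 ^+ 2 = q 0.
    have := sum_sqr_shift 1 0; rewrite addr0 => <-; rewrite /q.
    rewrite -(sum_ord_nat1 (F := fun k => g (k * G 0)%N ^+ 2)) //; last first.
      by rewrite mul0n g0 expr0n.
    by apply: eq_bigr => m _; rewrite addr0 muln1.
  rewrite /= big_ord0 mulr0 addr0 V0 mu0 subr0 [1%:R]/(1:R) !mul1r add0r.
  have V1 := block_var_ge0 1; have m1 := sqr_ge0 (mu 1).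
  have q0 := digit_energy_ge0 0.
  have G1 : 1 <= (G 1)%:R :> R by rewrite ler1n.
  have m2 : mu 1 ^+ 2 <= (G 1)%:R * mu 1 ^+ 2 by rewrite ler_peMl.
  have q2 : q 0 <= (G 1)%:R * q 0 by rewrite ler_peMl.
  by split; lra.
(* 27 = 3 + 6 * 4: the 3 is the direct contribution of [block_varSS], and the 6 * 4 is the error
   term of [block_mean_step] times the weight 6. *)
have -> : 7 * q 0 + 27 * \sum_(i < n.+1) (q i.+1 + q i) =
    7 * q 0 + 27 * \sum_(i < n) (q i.+1 + q i) + 27 * (q n.+1 + q n).
  by rewrite big_ord_recr /=; ring.
move: IH1 IH2; set P := 7 * q 0 + _ => IH1 IH2.
have hd := block_mean_step n; have hv := block_varSS n.
have G1 := Ggt0 n.+1; have G0 := Ggt0 n; have G2 := Ggt0 n.+2.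
have d0 := sqr_ge0 (mu n.+1 - mu n).
have q0 := digit_energy_ge0 n; have q1 := digit_energy_ge0 n.+1.
move: IH1 IH2 hd hv d0; move: ((mu n.+1 - mu n) ^+ 2) ((mu n.+2 - mu n.+1) ^+ 2).
move=> d d' IH1 IH2 hd hv d0; clearbody P.
have aa : 0 <= a%:R :> R by [].
have bb : 0 <= b%:R :> R by [].
split.
  have := ler_wpM2l (ltW G1) hd.
  by move: (mulr_ge0 (ltW G1) d0) (mulr_ge0 (ltW G1) q0) (mulr_ge0 (ltW G1) q1) IH2; lra.
have := ler_wpM2l (ltW G2) hd.
have := ler_wpM2l aa IH2; have := ler_wpM2l bb IH1.
by move: hv; rewrite Gr_SS; lra.
Qed.

Lemma block_var_le Q n : (forall N, \sum_(i < N) q i <= Q) ->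
  V n <= (G n)%:R * (64 * Q).
Proof.
move=> hQ; have [/= + _] := block_var_aux n.
have G0 := Ggt0 n; set d := _ ^+ 2; have d0 : 0 <= d := sqr_ge0 _.
have Q0 := hQ 1%N; rewrite big_ord_recr big_ord0 /= add0r in Q0.
have : \sum_(i < n) (q i.+1 + q i) <= 2 * Q.
  rewrite big_split /=; have := hQ n; have := hQ n.+1.
  rewrite big_ord_recl /=; under eq_bigr do rewrite /bump /=.
  by have := digit_energy_ge0 0; lra.
set S := \sum_(i < n) _ => hS.
(* Each level occurs at most twice in S, and 7 + 2 * 27 = 61 is rounded up to the square 64. *)
have hP : 7 * q 0 + 27 * S <= 64 * Q by have := digit_energy_ge0 0; lra.
have := ler_wpM2l (ltW G0) hP; have := mulr_ge0 (ltW G0) d0.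
by lra.
Qed.

End Moments.

(** * The mean and the series of the D_n *)

Lemma geometric_half_le (R : realFieldType) n : \sum_(j < n) (1 / 2) ^+ j <= 2 :> R.
Proof.
suff -> : \sum_(j < n) (1 / 2) ^+ j = 2 - 2 * (1 / 2) ^+ n :> R.
  by rewrite lerBlDr lerDl mulr_ge0 // exprn_ge0 // divr_ge0.
elim: n => [|n IH]; first by rewrite big_ord0 expr0 mulr1 subrr.
by rewrite big_ord_recr /= IH exprS; field.
Qed.

Lemma is_cvg_shiftS (R : realType) (u : R^nat) :
  cvgn (fun n => u n.+1) = cvgn u.
Proof.
by apply/propext; split=> /cvg_ex[l ul]; apply/cvg_ex; exists l; move: ul;
  rewrite (cvg_shiftS u).
Qed.

Section MeanVersusD.
Variables (R : realType) (a b : nat).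
Hypotheses (b_gt0 : (0 < b)%N) (le_ba : (b <= a)%N).
Local Notation G := (Defs.G a b).
Local Notation al := (alpha R a b).
Local Notation ka := (kappa R a b).
Local Notation be := (beta R a b).
Local Notation rh := (rho R a b).
Variable g : nat -> R.
Hypothesis gB : block_additive a b g.
Local Notation M := (block_sum a b g).
Local Notation mu := (block_mean a b g).

(* Dividing the recurrence of [M] by the root beta leaves a first order one. *)
Definition filtered_sum n := (M n.+1 - be * M n) / al ^+ n.+1.

(** The part of the inhomogeneous term not captured by kappa D: the first summand comes from the
    second term of [G_closed], the other from G_(n+1) - alpha G_n in [GS_alpha]. Both carry a factor
    beta^n. *)
Definition D_error n :=
  (1 - ka) * D a b g n.+1 + (a%:R + 1 - al) * \sum_(1 <= k < a) g (k * G n.+1)%N.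
Local Notation y := filtered_sum.
Local Notation c := D_error.

Let al_gt0 : 0 < al := alpha_gt0 R b_gt0 le_ba.
Let al_neq0 : al != 0. Proof. by rewrite gt_eqF. Qed.

(** With S the sum of the g(k G_(n+1)) over 1 <= k < a, the inhomogeneous term of [block_sumSS]
    equals G_n D_(n+1) + (G_(n+1) - alpha G_n) S. The closed forms of G_n and of this difference
    yield the main term and the error. *)
Lemma filtered_sumS n :
  y n.+1 = y n + al ^- 2 * (ka * D a b g n.+1 + rh ^+ n * c n).
Proof.
have ae : a%:R = al + be by rewrite /beta; ring.
have beE : b%:R = - (al * be) by rewrite (alphaM_beta R) opprK.
have an : al ^+ n != 0 by rewrite expf_neq0.
have GE := G_closed R b_gt0 le_ba n.
have GSE := GS_alpha R a b n.
have DE : D a b g n.+1 = al * (\sum_(1 <= k < a) g (k * G n.+1)%N)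
  + \sum_(1 <= k < b) g (k * G n)%N + b%:R * g (a * G n.+1)%N by [].
rewrite /y block_sumSS // GSE GE /c.
have rE : al ^+ n * rh ^+ n = be ^+ n.
  by rewrite -exprMn /rho mulrC divfK.
have -> : \sum_(1 <= k < b) g (k * G n)%N + b%:R * g (a * G n.+1)%N =
   D a b g n.+1 - al * \sum_(1 <= k < a) g (k * G n.+1)%N by rewrite DE; ring.
rewrite -rE beE ae !exprS.
by field; rewrite al_neq0 an.
Qed.

Lemma filtered_sumE n : y n = y 0 +
  al ^- 2 * (ka * (\sum_(1 <= j < n.+1) D a b g j) + \sum_(j < n) rh ^+ j * c j).
Proof.
elim: n => [|n IH]; first by rewrite big_geq // big_ord0 mulr0 addr0 mulr0 addr0.
by rewrite filtered_sumS IH [in RHS]big_ord_recr [in RHS]big_nat_recr //=; ring.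
Qed.

Lemma filtered_sum_mean n : y n =
  mu n.+1 * ((G n.+1)%:R / al ^+ n.+1) - rh * (mu n * ((G n)%:R / al ^+ n)).
Proof.
have an : al ^+ n != 0 by rewrite expf_neq0.
rewrite /y -!(mulG_mean a b_gt0) /rho exprS; field.
by rewrite an al_neq0.
Qed.

Lemma D_norm_le (X : R) n :
  (forall k, (k <= a)%N -> `|g (k * G n.+1)%N| <= X) ->
  (forall k, (k <= a)%N -> `|g (k * G n)%N| <= X) ->
  `|D a b g n.+1| <= (al * a%:R + b%:R + b%:R) * X.
Proof.
move=> gX1 gX; have X0 : 0 <= X by apply: le_trans (gX 0%N _).
have S1 : `|\sum_(1 <= k < a) g (k * G n.+1)%N| <= a%:R * X.
  by apply: (sum_norm_le (F := fun k => g (k * _)%N)) => // k /ltnW; exact: gX1.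
have S2 : `|\sum_(1 <= k < b) g (k * G n)%N| <= b%:R * X.
  apply: (sum_norm_le (F := fun k => g (k * _)%N)) => // k /ltnW kb.
  by apply: gX; exact: leq_trans kb le_ba.
rewrite /D 2!(mulrDl _ _ X); apply: le_trans (ler_normD _ _) _; apply: lerD.
  apply: le_trans (ler_normD _ _) _; apply: lerD => //.
  by rewrite normrM gtr0_norm // -mulrA ler_wpM2l // ltW.
by rewrite normrM normr_nat ler_wpM2l // gX1.
Qed.

Lemma D_error_le (X : R) : (forall n k, (k <= a)%N -> `|g (k * G n)%N| <= X) ->
  forall n, `|c n| <= (`|1 - ka| * (al * a%:R + b%:R + b%:R) + a%:R) * X.
Proof.
move=> gX n; have X0 : 0 <= X by apply: le_trans (gX 0%N 0%N _).
have S1 m : `|\sum_(1 <= k < a) g (k * G m)%N| <= a%:R * X.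
  by apply: (sum_norm_le (F := fun k => g (k * _)%N)) => // k /ltnW; exact: gX.
have S3 := D_norm_le (gX n.+1) (gX n).
rewrite /c; apply: le_trans (ler_normD _ _) _; rewrite (mulrDl _ _ X) !normrM; apply: lerD.
  by rewrite -mulrA ler_wpM2l.
rewrite -[X in _ <= X]mul1r; apply: ler_pM => //.
have := alpha_gea R b_gt0 le_ba; have := alpha_lea1 R b_gt0 le_ba => h1 h2.
by rewrite ger0_norm; lra.
Qed.

Lemma block_mean0 : mu 0 = 0.
Proof.
by rewrite /block_mean /block_sum big_ord_recl big_ord0 (block_additive0 gB) addr0 mul0r.
Qed.

(** The telescoped formula bounds the filtered sums by Z. Then mu_n G_n / alpha^n solves x_(n+1) =
    y_n + rho x_n with |rho| <= 1/2, which preserves the bound 2 Z, and G_n >= alpha^n removes the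
    factor. The bound is homogeneous in X and Y, so it becomes small for tails of f. *)
Lemma block_mean_le (X Y : R) : (forall n k, (k <= a)%N -> `|g (k * G n)%N| <= X) ->
  (forall N, `|\sum_(1 <= n < N) D a b g n| <= Y) -> forall n,
  `|mu n| <= 2 * (ka * Y +
     (a%:R + 1 + 2 * (`|1 - ka| * (al * a%:R + b%:R + b%:R) + a%:R)) * X).
Proof.
move=> gX DY; set C := `|1 - ka| * _ + _.
have X0 : 0 <= X by apply: le_trans (gX 0%N 0%N _).
have Y0 : 0 <= Y by apply: le_trans (DY 0%N).
have C0 : 0 <= C.
  by rewrite /C !(addr_ge0, mulr_ge0) // ltW.
have ka0 := ltW (kappa_gt0 R b_gt0 le_ba).
have al1 := alpha_ge1 R b_gt0 le_ba.
set Z := ka * Y + _.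
have y0 : `|y 0| <= (a%:R + 1) * X.
  rewrite /y /block_sum [\sum_(m < G 0) _]big_ord_recl big_ord0.
  rewrite (block_additive0 gB) addr0 mulr0 subr0 expr1 normrM normfV.
  rewrite (gtr0_norm al_gt0) ler_pdivrMr //.
  apply: le_trans (_ : (a%:R + 1) * X * 1 <= _); last first.
    by rewrite ler_wpM2l // mulr_ge0 // addr_ge0.
  rewrite mulr1 natr1; apply: le_trans (ler_norm_sum _ _ _) _.
  rewrite -[a.+1%:R * X]sum_constr; apply: ler_sum => k _.
  by have := gX 0%N k; rewrite muln1; apply; rewrite -ltnS.
have yZ n : `|y n| <= Z.
  rewrite filtered_sumE; apply: le_trans (ler_normD _ _) _.
  have A : `|\sum_(j < n) rh ^+ j * c j| <= 2 * (C * X).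
    apply: le_trans (ler_norm_sum _ _ _) _.
    apply: le_trans (_ : \sum_(j < n) (1 / 2) ^+ j * (C * X) <= _).
      apply: ler_sum => j _; rewrite normrM; apply: ler_pM => //.
        exact: expr_rho_norm.
      exact: D_error_le.
    by rewrite -mulr_suml ler_wpM2r ?mulr_ge0 // geometric_half_le.
  have B : `|ka * (\sum_(1 <= j < n.+1) D a b g j) + \sum_(j < n) rh ^+ j * c j|
     <= ka * Y + 2 * (C * X).
    by apply: le_trans (ler_normD _ _) _; apply: lerD => //;
       rewrite normrM (ger0_norm ka0) ler_wpM2l.
  have I : `|al ^- 2| <= 1.
    by rewrite normfV normrX (gtr0_norm al_gt0) invf_le1 ?exprn_gt0 // exprn_ege1.
  rewrite (normrM (al ^- 2)); have := ler_pM (normr_ge0 _) (normr_ge0 _) I B.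
  by rewrite mul1r /Z; lra.
have Z0 : 0 <= Z := le_trans (normr_ge0 _) (yZ 0%N).
have m n : `|mu n * ((G n)%:R / al ^+ n)| <= 2 * Z.
  elim: n => [|n IH]; first by rewrite block_mean0 mul0r normr0 mulr_ge0.
  have -> : mu n.+1 * ((G n.+1)%:R / al ^+ n.+1) = y n + rh * (mu n * ((G n)%:R / al ^+ n)).
    by rewrite filtered_sum_mean subrK.
  apply: le_trans (ler_normD _ _) _; rewrite (normrM rh).
  by have := ler_pM (normr_ge0 _) (normr_ge0 _) (rho_norm R b_gt0 le_ba) IH; have := yZ n; lra.
move=> n; apply: le_trans (m n); rewrite (normrM (mu n)) ler_peMr //.
have an : 0 < al ^+ n by rewrite exprn_gt0.
have h : 0 <= (G n)%:R / al ^+ n by rewrite divr_ge0 // ltW.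
rewrite (ger0_norm h) ler_pdivlMr // mul1r.
exact: G_gealpha.
Qed.

(** [filtered_sumE] is solved for the partial sums of D, which kappa != 0 permits; the error series
    converges absolutely, being geometric times bounded. *)
Lemma D_sum_cvg (X : R) : (forall n k, (k <= a)%N -> `|g (k * G n)%N| <= X) ->
  cvgn mu -> cvgn (fun N => \sum_(1 <= n < N) D a b g n).
Proof.
move=> gX cmu; have ka0 := kappa_gt0 R b_gt0 le_ba.
set C := (`|1 - ka| * (al * a%:R + b%:R + b%:R) + a%:R) * X.
have cc : cvgn (fun n => \sum_(j < n) rh ^+ j * c j).
  have -> : (fun n => \sum_(j < n) rh ^+ j * c j) = series (fun j => rh ^+ j * c j).
    by rewrite seriesEord.
  apply: normed_cvg.
  apply: (@series_le_cvg _ _ (fun j => C * (1 / 2) ^+ j)).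
  - by move=> n /=.
  - move=> n; rewrite mulr_ge0 ?exprn_ge0 // /C.
    exact: le_trans (normr_ge0 _) (D_error_le gX 0).
  - move=> n /=; rewrite normrM mulrC; apply: ler_pM => //.
      exact: D_error_le.
    exact: expr_rho_norm.
  - apply: is_cvg_geometric_series; rewrite ger0_norm //; lra.
have cG := @G_alpha_cvg R a b b_gt0 le_ba.
have cy : cvgn y.
  have -> : y = (fun n => mu n.+1 * ((G n.+1)%:R / al ^+ n.+1) -
      rh * (mu n * ((G n)%:R / al ^+ n))).
    by apply/funext => n; exact: filtered_sum_mean.
  have c0 : cvgn (fun n => mu n * ((G n)%:R / al ^+ n)).
    by apply: is_cvgM => //; apply/cvg_ex; eexists; exact: cG.
  apply: is_cvgB; last by apply: is_cvgMr.
  by rewrite (is_cvg_shiftS (fun n => mu n * ((G n)%:R / al ^+ n))).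
have E n : \sum_(1 <= j < n.+1) D a b g j =
    ka^-1 * (al ^+ 2 * (y n - y 0) - \sum_(j < n) rh ^+ j * c j).
  rewrite [in y n]filtered_sumE addrAC subrr add0r.
  rewrite mulrA divff ?expf_neq0 // mul1r addrK mulrA mulVf ?mul1r //.
  by rewrite gt_eqF.
have cS : cvgn (fun n => \sum_(1 <= j < n.+1) D a b g j).
  under eq_fun do rewrite E.
  apply: is_cvgMr; apply: is_cvgB => //; apply: is_cvgMr; apply: is_cvgB => //.
  exact: is_cvg_cst.
by rewrite -(is_cvg_shiftS (fun N => \sum_(1 <= n < N) D a b g n)).
Qed.

End MeanVersusD.

(** * Averages of functions of finitely many digits *)

Section SequenceTools.
Variable R : realType.
Implicit Types u : R^nat.

Lemma cvgn_cauchyP u :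
  (forall e, 0 < e -> exists N, forall n, (N <= n)%N -> `|u n - u N| <= e) ->
  cvgn u.
Proof.
move=> h; apply: cauchy_cvg; apply/cauchy_exP => e e0.
have [|N hN] := h (e / 2); first by rewrite divr_gt0.
exists (u N); exists N => //= n /= Nn; rewrite /ball /= /ball_ distrC.
by apply: le_lt_trans (hN n Nn) _; lra.
Qed.

Lemma cvgn_cauchy u : cvgn u ->
  forall e, 0 < e -> exists N, forall n m, (N <= n)%N -> (N <= m)%N ->
    `|u n - u m| <= e.
Proof.
move=> /cvgrPdist_le cu e e0; have [|N _ hN] := cu (e / 2); first by rewrite divr_gt0.
exists N => n m Nn Nm; have := hN n Nn; have := hN m Nm => /= h1 h2.
rewrite -(subrKA (limn u)) (splitr e).
by apply: le_trans (ler_normD _ _) _; rewrite lerD // distrC.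
Qed.

Lemma contracting_cvg u K :
  (forall n, (K <= n)%N -> `|u n.+2 - u n.+1| <= 1 / 2 * `|u n.+1 - u n|) ->
  cvgn u.
Proof.
move=> h; pose A := `|u K.+1 - u K|.
have step j : `|u (K + j).+1 - u (K + j)%N| <= A * (1 / 2) ^+ j.
  elim: j => [|j IH]; first by rewrite addn0 expr0 mulr1.
  rewrite addnS; apply: le_trans (h _ (leq_addr _ _)) _.
  by rewrite exprS mulrCA ler_wpM2l.
have far i j : `|u (K + i + j)%N - u (K + i)%N| <= 2 * A * (1 / 2) ^+ i.
  have -> : u (K + i + j)%N - u (K + i)%N = \sum_(l < j) (u (K + i + l).+1 - u (K + i + l)%N).
    elim: j => [|j IH]; first by rewrite addn0 subrr big_ord0.
    by rewrite big_ord_recr /= -IH addnS; ring.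
  apply: le_trans (ler_norm_sum _ _ _) _.
  apply: le_trans (_ : \sum_(l < j) A * (1 / 2) ^+ i * (1 / 2) ^+ l <= _).
    by apply: ler_sum => l _; rewrite -mulrA -exprD -!addnA step.
  rewrite -mulr_sumr; have := geometric_half_le R j.
  have Ai : 0 <= A * (1 / 2) ^+ i by rewrite mulr_ge0 ?normr_ge0 ?exprn_ge0 ?divr_ge0.
  by move=> /(ler_wpM2l Ai); lra.
have c0 : (2 * A) * (1 / 2) ^+ i @[i --> \oo] --> (0 : R).
  rewrite -[X in _ --> X](mulr0 (2 * A)); apply: cvgMr.
  by apply: cvg_expr; rewrite ger0_norm; lra.
apply: cvgn_cauchyP => e e0.
have /cvgrPdist_le/(_ _ e0)[i _ hi] := c0.
exists (K + i)%N => n Kn; have := hi i (leqnn _); rewrite /= sub0r normrN => hie.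
rewrite -(subnKC Kn); apply: le_trans (far _ _) (le_trans (ler_norm _) hie).
Qed.

End SequenceTools.

Section Averages.
Variables (R : realType) (a b : nat).
Hypotheses (b_gt0 : (0 < b)%N) (le_ba : (b <= a)%N).
Local Notation G := (Defs.G a b).

Definition avg (phi : nat -> R) (N : nat) := (\sum_(m < N) phi m) / N%:R.

(** Dependence on the digits of index below K only, expressed through leading digits so that it fits
    the block decomposition directly. *)
Definition low_digits K (phi : nat -> R) := forall n k m, (K <= n)%N ->
  (m < G n)%N -> (k * G n + m < G n.+1)%N -> phi (k * G n + m)%N = phi m.

Variables (K : nat) (phi : nat -> R).
Hypothesis phiK : low_digits K phi.

Lemma low_digits_sumSS n : (K <= n)%N ->
  \sum_(m < G n.+2) phi m =
  a%:R * \sum_(m < G n.+1) phi m + b%:R * \sum_(m < G n) phi m.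
Proof.
move=> Kn; rewrite sum_GSS -!sum_constr; congr (_ + _); apply: eq_bigr => k _;
  apply: eq_bigr => m _.
  by rewrite phiK ?ltn_block // (leq_trans Kn).
have ka : (k < a)%N := leq_trans (ltn_ord k) le_ba.
by rewrite phiK ?ltn_topblock ?ltn_block ?(leq_trans Kn) // phiK // ltn_block.
Qed.

(** The block sums satisfy the recurrence of [G] itself from level K on, so the increments of the
    averages obey the homogeneous form of [block_meanSS] and contract by 1/2. *)
Lemma low_digits_avgG_cvg : cvgn (fun n => avg phi (G n)).
Proof.
have G0 n := Gr_gt0 R a b_gt0 n.
have E n : \sum_(m < G n) phi m = (G n)%:R * avg phi (G n).
  by rewrite /avg mulrC divfK // gt_eqF.
apply: (@contracting_cvg _ _ K) => n Kn.
set d := avg phi (G n); set d1 := avg phi (G n.+1); set d2 := avg phi (G n.+2).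
have H : (G n.+2)%:R * (d2 - d1) = - (b%:R * (G n)%:R) * (d1 - d).
  have := low_digits_sumSS Kn; rewrite !E -/d -/d1 -/d2 mulrBr => ->.
  by rewrite Gr_SS; ring.
have bG : 0 <= b%:R * (G n)%:R :> R by rewrite mulr_ge0.
rewrite -(ler_pM2l (G0 n.+2)) -[X in X * `|d2 - d1|](gtr0_norm (G0 n.+2)) -normrM H.
rewrite normrM normrN (ger0_norm bG) mulrA [_ * (1 / 2)]mulrC ler_wpM2r //.
exact: Gr_half.
Qed.

(** Leading digits of N are peeled off one at a time. Each removed block of length G_j with j >= J
    contributes at most e G_j, and the remainder below G_J contributes a constant independent of
    N. *)
Lemma low_digits_sum_dev L e J : 0 <= e -> (K <= J)%N ->
  (forall n, (J <= n)%N -> `|avg phi (G n) - L| <= e) ->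
  forall N, `|\sum_(m < N) phi m - L * N%:R| <=
     e * N%:R + \sum_(m < G J) `|phi m - L|.
Proof.
move=> e0 KJ hJ N; set C := \sum_(m < G J) _.
have G0 n := Gr_gt0 R a b_gt0 n.
have [n NG] : exists n, (N < G (J + n))%N.
  by exists N; apply: leq_trans (ltn_G b_gt0 le_ba N) _; apply: leq_G => //; exact: leq_addl.
have C0 : 0 <= C by apply: sumr_ge0 => m _.
elim: n N NG => [|n IH] N NG.
  rewrite addn0 in NG; rewrite -[X in `|X|]mulr1; apply: le_trans (_ : C <= _).
    have -> : (\sum_(m < N) phi m - L * N%:R) * 1 = \sum_(m < N) (phi m - L).
      by rewrite sumrB sum_constr mulr1 [L * _]mulrC.
    apply: le_trans (ler_norm_sum _ _ _) _.
    rewrite /C -(subnKC (ltnW NG)) big_split_ord /= lerDl.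
    by apply: sumr_ge0 => m _.
  by rewrite lerDr mulr_ge0.
rewrite addnS in NG; set j := (J + n)%N in IH NG.
have Jj : (J <= j)%N by exact: leq_addr.
have Kj : (K <= j)%N by exact: leq_trans Jj.
rewrite (divn_eq N (G j)); set k := (N %/ G j)%N; set m0 := (N %% G j)%N.
have m0G : (m0 < G j)%N by rewrite ltn_mod G_gt0.
have NE : N = (k * G j + m0)%N := divn_eq N (G j).
rewrite big_split_ord /= sum_blocks.
have -> : \sum_(i < k) \sum_(m < G j) phi (i * G j + m)%N =
    k%:R * \sum_(m < G j) phi m.
  rewrite -sum_constr; apply: eq_bigr => i _; apply: eq_bigr => m _.
  rewrite phiK // (leq_trans _ (ltnW NG)) // NE.
  apply: leq_trans (leq_addr _ _); apply: leq_trans (_ : (i.+1 * G j <= _)%N).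
    by rewrite mulSn addnC ltn_add2r.
  by rewrite leq_mul2r ltn_ord orbT.
have -> : \sum_(i < m0) phi (k * G j + i)%N = \sum_(i < m0) phi i.
  apply: eq_bigr => i _; rewrite phiK // ?(ltn_trans (ltn_ord i)) //.
  by rewrite (leq_ltn_trans _ NG) // NE leq_add2l ltnW.
have := IH _ m0G; have := hJ _ Jj.
have -> : \sum_(m < G j) phi m = (G j)%:R * avg phi (G j).
  by rewrite /avg mulrC divfK // gt_eqF.
set A := avg _ _; set S := \sum_(i < m0) _ => h1 h2.
rewrite natrD natrM.
have -> : k%:R * ((G j)%:R * A) + S - L * (k%:R * (G j)%:R + m0%:R) =
   k%:R * (G j)%:R * (A - L) + (S - L * m0%:R) by ring.
apply: le_trans (ler_normD _ _) _.
have kG : 0 <= k%:R * (G j)%:R :> R by rewrite mulr_ge0.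
rewrite normrM (ger0_norm kG).
by have := ler_wpM2l kG h1; lra.
Qed.

Lemma low_digits_avg_cvg : cvgn (avg phi).
Proof.
have cG := low_digits_avgG_cvg; set L := limn (fun n => avg phi (G n)) in cG.
apply/cvg_ex; exists L; apply/cvgrPdist_le => e e0.
have e2 : 0 < e / 2 by rewrite divr_gt0.
have [J0 _ hJ0] := (cvgrPdist_le _ _).1 cG _ e2.
have dev := @low_digits_sum_dev L (e / 2) (maxn K J0) (ltW e2) (leq_maxl _ _).
have {}dev N : `|\sum_(m < N) phi m - L * N%:R| <=
    e / 2 * N%:R + \sum_(m < G (maxn K J0)) `|phi m - L|.
  apply: dev => n Jn; rewrite distrC; apply: (hJ0 n) => /=.
  by apply: leq_trans Jn; exact: leq_maxr.
move: dev; set C := \sum_(m < G _) _ => dev.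
have C0 : 0 <= C by apply: sumr_ge0.
exists (Num.truncn (C / (e / 2))).+1 => // N /= hN.
have N0 : 0 < N%:R :> R by rewrite ltr0n (leq_trans _ hN).
have hC : C <= e / 2 * N%:R.
  rewrite mulrC -ler_pdivrMr //; apply: ltW.
  apply: lt_le_trans (truncnS_gt _) _; by rewrite ler_nat.
rewrite distrC /avg -(ler_pM2r N0) -[X in _ * X <= _](gtr0_norm N0) -normrM.
rewrite mulrBl divfK ?gt_eqF //.
by apply: le_trans (dev N) _; lra.
Qed.

End Averages.

(** * Second moments over arbitrary initial segments *)

Section SecondMoment.
Variables (R : realType) (a b : nat).
Hypotheses (b_gt0 : (0 < b)%N) (le_ba : (b <= a)%N).
Local Notation G := (Defs.G a b).

(** The constant does not depend on g. Applied to the tails of f, whose X can be made arbitrarily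
    small, this is what makes truncation uniform in N. *)
Lemma second_moment_le : exists2 C : R, 0 <= C &
  forall g : nat -> R, block_additive a b g -> forall X : R, 0 <= X ->
  (forall N, \sum_(i < N) digit_energy a b g i <= X ^+ 2) ->
  (forall N, `|\sum_(1 <= n < N) D a b g n| <= X) ->
  (forall N, \sum_(m < N) g m ^+ 2 <= C * X ^+ 2 * N%:R).
Proof.
have G0 n := Gr_gt0 R a b_gt0 n.
pose c := 2 * (kappa R a b + (a%:R + 1 + 2 *
  (`|1 - kappa R a b| * (alpha R a b * a%:R + b%:R + b%:R) + a%:R))).
exists ((a.+1)%:R * (64 + c ^+ 2)).
  by rewrite mulr_ge0 // addr_ge0 // sqr_ge0.
move=> g gB X X0 hq hD.
have gX n k : (k <= a)%N -> `|g (k * G n)%N| <= X.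
  move=> ka; rewrite -(ger0_norm X0) -ler_sqr ?nnegrE // !real_normK ?num_real //.
  apply: le_trans (digit_sq_le gB n ka) _; apply: le_trans (hq n.+1).
  by rewrite big_ord_recr /= lerDr sumr_ge0 // => i _; exact: digit_energy_ge0.
have muX n : block_mean a b g n ^+ 2 <= c ^+ 2 * X ^+ 2.
  rewrite -exprMn -[leLHS]real_normK ?num_real // ler_sqr ?nnegrE //.
    by apply: le_trans (block_mean_le b_gt0 le_ba gB gX hD n) _; rewrite /c; lra.
  have := le_trans (normr_ge0 _) (block_mean_le b_gt0 le_ba gB gX hD 0).
  by rewrite /c; lra.
have hG n : \sum_(m < G n) g m ^+ 2 <= (64 + c ^+ 2) * X ^+ 2 * (G n)%:R.
  have := sum_sqr_shift a b_gt0 g n 0.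
  rewrite (eq_bigr (fun m : 'I__ => g m ^+ 2)) => [->|m _]; last by rewrite addr0.
  have := block_var_le b_gt0 le_ba gB n hq.
  by rewrite addr0; have := ler_wpM2l (ltW (G0 n)) (muX n); lra.
case=> [|N]; first by rewrite big_ord0 mulr0.
(* The segment is enlarged to the next full block; since G_(J+1) <= (a+1) G_J <= (a+1) N this costs
   the factor a+1. *)
have [J GJ NJ] := G_bracket b_gt0 le_ba (ltn0Sn N).
apply: le_trans (_ : \sum_(m < G J.+1) g m ^+ 2 <= _).
  rewrite -(subnKC (ltnW NJ)) big_split_ord /= lerDl.
  by apply: sumr_ge0 => m _; exact: sqr_ge0.
apply: le_trans (hG _) _.
have A : (G J.+1)%:R <= a.+1%:R * N.+1%:R :> R.
  rewrite -natrM ler_nat; apply: leq_trans (leq_GS le_ba J) _.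
  by rewrite leq_mul2l GJ orbT.
have B : 0 <= (64 + c ^+ 2) * X ^+ 2.
  by rewrite mulr_ge0 ?sqr_ge0 // addr_ge0 ?sqr_ge0.
by have := ler_wpM2l B A; lra.
Qed.

End SecondMoment.

(** * Limits of Levy-Cauchy sequences of distribution functions *)

Section LevyCauchy.
Variables (R : realType) (F_ : nat -> R -> R).
Hypothesis F_nd : forall N, nondecreasing (F_ N).
Hypothesis F_ge0 : forall N x, 0 <= F_ N x.
Hypothesis F_le1 : forall N x, F_ N x <= 1.
Hypothesis F_cauchy : forall e x, 0 < e -> exists N0, forall N N',
  (N0 <= N)%N -> (N0 <= N')%N -> F_ N x <= F_ N' (x + e) + e.
Hypothesis F_tight : forall e, 0 < e -> exists M N0, forall N, (N0 <= N)%N ->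
  F_ N (- M) <= e /\ 1 - e <= F_ N M.

(** The limit F x is the infimum over y > x of the upper limit of F_N y; [A x] collects the eventual
    upper bounds. The strict inequality x < y builds in right continuity. *)
Let A x := [set z : R | exists2 y, x < y &
  exists N0, forall N, (N0 <= N)%N -> F_ N y <= z].
Let F x := inf (A x).

Let A_lb x : lbound (A x) 0.
Proof.
by move=> z [y _ [N0 h]]; apply: le_trans (h N0 (leqnn _)); exact: F_ge0.
Qed.

Let A1 x : A x 1.
Proof. by exists (x + 1); [rewrite ltrDl|exists 0%N => N _]. Qed.

Let F_leP x y z N0 : x < y -> (forall N, (N0 <= N)%N -> F_ N y <= z) -> F x <= z.
Proof.
move=> xy h; apply: ge_inf; first by exists 0; exact: A_lb.
by exists y => //; exists N0.
Qed.

Let F_ltP x z : F x < z -> exists2 y, x < y &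
  exists N0, forall N, (N0 <= N)%N -> F_ N y <= z.
Proof.
move=> Fz; have hi : has_inf (A x).
  by split; [exists 1; exact: A1 | exists 0; exact: A_lb].
have [|w [y xy [N0 h]] wz] := @inf_adherent _ _ (z - F x) _ hi.
  by rewrite subr_gt0.
rewrite addrC subrK in wz.
by exists y => //; exists N0 => N /h /le_trans; apply; exact: ltW.
Qed.

Let F0 x : 0 <= F x.
Proof. by apply: lb_le_inf; [exists 1; exact: A1|exact: A_lb]. Qed.

Let F1 x : F x <= 1.
Proof. by apply: (@F_leP _ (x + 1) _ 0%N); rewrite ?ltrDl. Qed.

Let Fnd : nondecreasing F.
Proof.
move=> x x' xx'; rewrite leNgt; apply/negP => h.
have [|y x'y [N0 hy]] := @F_ltP x' ((F x' + F x) / 2); first by lra.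
have := F_leP (le_lt_trans xx' x'y) hy; lra.
Qed.

Let Frc : right_continuous F.
Proof.
move=> x; apply/cvgrPdist_le => e e0.
have [|y xy [N0 hy]] := @F_ltP x (F x + e); first by rewrite ltrDl.
near=> x'.
have xx' : x < x' by near: x'; exact: nbhs_right_gt.
have x'y : x' < y by near: x'; exact: nbhs_right_lt.
have h1 := Fnd (ltW xx'); have h2 := F_leP x'y hy.
by rewrite distrC ger0_norm; lra.
Unshelve. all: end_near. Qed.

Let FNy : F @ -oo --> (0 : R).
Proof.
apply/cvgrPdist_le => e e0; have [M [N0 hM]] := F_tight e0.
near=> x.
have xM : x < - M by near: x; apply: nbhs_ninfty_lt; rewrite num_real.
rewrite sub0r normrN ger0_norm //.
by apply: (@F_leP _ (- M) _ N0) => // N /hM[].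
Unshelve. all: end_near. Qed.

Let Fy : F @ +oo --> (1 : R).
Proof.
apply/cvgrPdist_le => e e0; have [M [N0 hM]] := F_tight e0.
near=> x.
have xM : M <= x by near: x; apply: nbhs_pinfty_ge; rewrite num_real.
have := F1 x; rewrite -subr_ge0 => /ger0_norm ->.
rewrite lerBlDr -lerBlDl; apply: lb_le_inf; first by exists 1; exact: A1.
move=> z [y xy [N1 hy]].
have [_ h] := hM (maxn N0 N1) (leq_maxl _ _).
apply: le_trans h _; apply: le_trans (hy (maxn N0 N1) (leq_maxr _ _)).
by apply: F_nd; rewrite (le_trans xM) // ltW.
Unshelve. all: end_near. Qed.

Lemma levy_cauchy_limit : exists F : cumulativeBounded (0 : R) (1 : R),
  forall x, {for x, continuous F} -> F_ N x @[N --> \oo] --> F x.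
Proof.
pose Fc : cumulativeBounded (0 : R) (1 : R) :=
  HB.pack F (isCumulative.Build R _ R F Fnd Frc)
            (isCumulativeBounded.Build R 0 1 F FNy Fy).
exists Fc => x cx; apply/cvgrPdist_le => e e0.
have e2 : 0 < e / 2 by rewrite divr_gt0.
have [|y xy [N1 hy]] := @F_ltP x (F x + e); first by rewrite ltrDl.
have /cvgrPdist_le/(_ _ e2) [d /= d0 hd] := cx.
pose d' := Num.min (d / 3) (e / 2).
have d'0 : 0 < d' by rewrite lt_min e2 divr_gt0.
have d'd : d' <= d / 3 by rewrite ge_min lexx.
have d'e : d' <= e / 2 by rewrite ge_min lexx orbT.
have [N2 h2] := F_cauchy (x - d') d'0.
exists (maxn N1 N2) => // N /= hN.
have N1N : (N1 <= N)%N by apply: leq_trans hN; exact: leq_maxl.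
have N2N : (N2 <= N)%N by apply: leq_trans hN; exact: leq_maxr.
have u1 : F_ N x <= F x + e by apply: le_trans (hy N N1N); apply: F_nd; exact: ltW.
(* The Levy condition compares this fixed N with all large N' at the point x - d', so the right-hand
   side is an eventual upper bound there and hence bounds F at x - 2 d'. The choice d' <= d / 3
   keeps this point within the continuity radius of x. *)
have u2 : F (x - 2 * d') <= F_ N x + d'.
  apply: (@F_leP _ (x - d') _ N2); first by lra.
  by move=> N' N2N'; have := h2 N' N N2N' N2N; rewrite subrK.
have u3 : `|F x - F (x - 2 * d')| <= e / 2.
  by apply: hd; rewrite /ball_ /= opprB addrC subrK ger0_norm; lra.
rewrite ler_norml; move: u3; rewrite ler_norml => /andP[_ u3].
change (Fc x) with (F x).
by apply/andP; split; lra.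
Qed.

End LevyCauchy.

(** * Empirical distribution functions as averages; the Chebyshev inequality *)

Section AveragesOrder.
Variable R : realType.
Implicit Types (phi psi : nat -> R).

Lemma empirical_avg (f : nat -> R) N x :
  empirical_cdf f N x = avg (fun n => (f n <= x)%R%:R) N.
Proof.
rewrite /empirical_cdf /avg -sum1_card natr_sum big_mkcond /=; congr (_ / _).
by apply: eq_bigr => i _; rewrite inE; case: (_ <= _).
Qed.

Lemma ler_avg phi psi N : (forall n, phi n <= psi n) -> avg phi N <= avg psi N.
Proof. by move=> h; rewrite /avg ler_wpM2r ?invr_ge0 //; apply: ler_sum => i _. Qed.

Lemma avgD phi psi N : avg (fun n => phi n + psi n) N = avg phi N + avg psi N.
Proof. by rewrite /avg big_split mulrDl. Qed.

Lemma avg_cst (c : R) N : (0 < N)%N -> avg (fun=> c) N = c.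
Proof.
by move=> N0; rewrite /avg sum_constr mulrAC divff ?mul1r // pnatr_eq0 -lt0n.
Qed.

Lemma avg_ge0 phi N : (forall n, 0 <= phi n) -> 0 <= avg phi N.
Proof. by move=> h; rewrite /avg divr_ge0 // sumr_ge0. Qed.

Lemma avg_le phi N c : 0 <= c -> \sum_(m < N) phi m <= c * N%:R -> avg phi N <= c.
Proof.
case: N => [|N] c0 h; first by rewrite /avg big_ord0 mul0r.
by rewrite /avg ler_pdivrMr ?ltr0n.
Qed.

Lemma avg_chebyshev (h : nat -> R) N e c : 0 < e -> 0 <= c ->
  \sum_(m < N) h m ^+ 2 <= c * N%:R ->
  avg (fun n => (e < `|h n|)%R%:R) N <= c / e ^+ 2.
Proof.
move=> e0 c0 hc; have e2 : 0 < e ^+ 2 by rewrite exprn_gt0.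
apply: avg_le; first by rewrite divr_ge0 // ltW.
rewrite mulrAC ler_pdivlMr // mulr_suml; apply: le_trans hc.
apply: ler_sum => m _; case: ltP => /= he; last by rewrite mul0r sqr_ge0.
by rewrite mul1r -[leRHS]real_normK ?num_real // ler_sqr ?nnegrE // ltW.
Qed.

End AveragesOrder.

(** * Sufficiency *)

Lemma cvgn_bounded (R : realType) (u : R^nat) : cvgn u ->
  exists2 B, 0 <= B & forall n, `|u n| <= B.
Proof.
move=> /cvgn_cauchy/(_ 1 ltr01)[N hN].
exists (1 + \sum_(i < N.+1) `|u i|); first by rewrite addr_ge0 // sumr_ge0.
move=> n; case: (ltnP n N.+1) => nN.
  rewrite (bigD1 (Ordinal nN)) //= addrCA lerDl addr_ge0 //.
  exact: sumr_ge0.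
have h := hN n N (ltnW nN) (leqnn N).
rewrite -(subrK (u N) (u n)); apply: le_trans (ler_normD _ _) _; apply: lerD => //.
by rewrite big_ord_recr /= lerDr sumr_ge0.
Qed.

Section Sufficiency.
Variables (R : realType) (a b : nat).
Hypotheses (b_gt0 : (0 < b)%N) (le_ba : (b <= a)%N).
Local Notation G := (Defs.G a b).
Variable f : nat -> R.
Hypothesis fB : block_additive a b f.
Local Notation q := (digit_energy a b f).
Local Notation low K := (truncate_low a b f K).
Local Notation tail K := (fun n => f n - truncate_low a b f K n).

Let f0 : f 0%N = 0 := block_additive0 fB.

Lemma tail_energy K n :
  digit_energy a b (tail K) n = if (n < K)%N then 0 else q n.
Proof.
rewrite /digit_energy.
under eq_big_nat => k /andP[_ ka] do rewrite tail_kG //.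
by case: ltnP => // _; rewrite big1 // => k _; rewrite expr0n.
Qed.

(** Level K is left out here and in [tail_D_high]: D_K mixes the retained values f(kG_K) with the
    deleted f(kG_(K-1)), so it has to be estimated separately. *)
Lemma tail_D_low K n : (0 < n < K)%N -> D a b (tail K) n = 0.
Proof.
case: n => // n /= nK; rewrite /D /=.
rewrite tail_kG // nK mulr0 addr0.
under eq_big_nat => k /andP[_ ka] do rewrite tail_kG ?(ltnW ka) // nK.
under [X in _ + X]eq_big_nat => k /andP[_ kb] do
  rewrite tail_kG ?(leq_trans (ltnW kb)) // (ltnW nK).
by rewrite !big1 // mulr0 addr0.
Qed.

Lemma tail_D_high K n : (K < n)%N -> D a b (tail K) n = D a b f n.
Proof.
case: n => // n /= Kn; rewrite /D /=.
rewrite tail_kG // ltnNge ltnW //=.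
under eq_big_nat => k /andP[_ ka] do rewrite tail_kG ?(ltnW ka) // ltnNge ltnW //=.
under [X in _ + X + _ = _]eq_big_nat => k /andP[_ kb] do
  rewrite tail_kG ?(leq_trans (ltnW kb)) // ltnNge -ltnS Kn /=.
by [].
Qed.

Hypothesis cq : cvgn (fun N => \sum_(n < N) q n).

Lemma tail_energy_small (d : R) : 0 < d -> exists K0, forall K, (K0 <= K)%N ->
  forall N, \sum_(i < N) digit_energy a b (tail K) i <= d.
Proof.
move=> d0; have [K0 hK0] := cvgn_cauchy cq d0; exists K0 => K KK N.
have h := hK0 (maxn N K) K (leq_trans KK (leq_maxr _ _)) KK.
apply: le_trans h; apply: le_trans (ler_norm _).
rewrite -!(big_mkord xpredT) (big_cat_nat (n := K) (p := maxn N K)) ?leq_maxr //=.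
rewrite addrAC subrr add0r.
apply: le_trans (_ : \sum_(0 <= i < maxn N K) digit_energy a b (tail K) i <= _).
  rewrite (big_cat_nat (n := N) (p := maxn N K)) ?leq_maxl //= lerDl.
  by apply: sumr_ge0 => i _; exact: digit_energy_ge0.
rewrite (big_cat_nat (n := K)) ?leq_maxr //= [X in X + _ <= _]big1_seq ?add0r.
  rewrite le_eqVlt; apply/orP; left; apply/eqP/eq_big_nat => i /andP[Ki _].
  by rewrite tail_energy ltnNge Ki.
by move=> i; rewrite mem_index_iota /= => iK; rewrite tail_energy iK.
Qed.

Hypothesis cD : cvgn (fun N => \sum_(1 <= n < N) D a b f n).
Lemma second_moment_bounded : exists2 C, 0 <= C &
  forall N, \sum_(m < N) f m ^+ 2 <= C * N%:R.
Proof.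
have [C C0 hC] := second_moment_le R b_gt0 le_ba.
have [B1 B10 hB1] := cvgn_bounded cD; have [B2 B20 hB2] := cvgn_bounded cq.
(* The summand 1 makes X >= 1, so that X^2 >= X also dominates the bound B2 of the energies. *)
exists (C * (B1 + B2 + 1) ^+ 2); first by rewrite mulr_ge0 ?sqr_ge0.
apply: hC => //; first by lra.
  by move=> N; apply: le_trans (ler_norm _) (le_trans (hB2 N) _); nra.
by move=> N; apply: le_trans (hB1 N) _; lra.
Qed.

Lemma second_moment_tail (e : R) : 0 < e ->
  exists K, forall N, \sum_(m < N) (tail K m) ^+ 2 <= e * N%:R.
Proof.
move=> e0; have [C C0 hC] := second_moment_le R b_gt0 le_ba.
(* X <= 1 gives C X^2 <= C X <= e. *)
pose X := Num.min 1 (e / (C + 1)).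
have C1 : 0 < C + 1 by lra.
have X0 : 0 < X by rewrite lt_min ltr01 divr_gt0.
have X1 : X <= 1 by rewrite ge_min lexx.
have Xe : X * (C + 1) <= e by rewrite -ler_pdivlMr // ge_min lexx orbT.
have CX : C * X ^+ 2 <= e by nra.
pose c := alpha R a b * a%:R + b%:R + b%:R.
have al0 := alpha_gt0 R b_gt0 le_ba.
have c0 : 0 <= c by rewrite /c !addr_ge0 // mulr_ge0 // ltW.
(* All digit values of the tail will be at most d, so the exceptional term D_K is at most c d <= X /
   2; the other X / 2 is left for the Cauchy tail of the series of D. *)
pose d := X / (2 * (c + 1)).
have d0 : 0 < d by rewrite divr_gt0 //; lra.
have dX : 2 * (c + 1) * d = X by rewrite /d mulrC divfK // gt_eqF //; lra.
have [K1 hK1] := cvgn_cauchy cD (divr_gt0 X0 (ltr0Sn R 1)).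
have [K2 hK2] := tail_energy_small (exprn_gt0 2 d0).
(* A successor, because [D_norm_le] concerns two consecutive levels. *)
pose K := (maxn K1 K2).+1.
have K1K : (K1 <= K)%N by rewrite leqW // leq_maxl.
have K2K : (K2 <= K)%N by rewrite leqW // leq_maxr.
have gB := additive_tail b_gt0 le_ba K fB.
have hq N : \sum_(i < N) digit_energy a b (tail K) i <= d ^+ 2 by exact: hK2.
have g0 : f 0%N - low K 0 = 0 := block_additive0 gB.
have gd n k : (k <= a)%N -> `|f (k * G n)%N - low K (k * G n)| <= d.
  move=> ka; rewrite -(gtr0_norm d0) -ler_sqr ?nnegrE // !real_normK ?num_real //.
  apply: le_trans (digit_sq_le gB n ka) _; apply: le_trans (hq n.+1).
  by rewrite big_ord_recr /= lerDr sumr_ge0 // => i _; exact: digit_energy_ge0.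
have DK : `|D a b (tail K) K| <= c * d.
  by apply: (D_norm_le (n := maxn K1 K2) b_gt0 le_ba) => k; exact: gd.
have hD N : `|\sum_(1 <= n < N) D a b (tail K) n| <= X.
  case: (leqP N K) => NK.
    rewrite big1_seq ?normr0 ?(ltW X0) // => i; rewrite mem_index_iota /= => /andP[i1 iN].
    by rewrite tail_D_low // i1 (leq_trans iN).
  rewrite (big_cat_nat (n := K)) ?ltnS //=; last exact: ltnW.
  rewrite [X in X + _]big1_seq ?add0r; last first.
    by move=> i; rewrite mem_index_iota /= => h; rewrite tail_D_low.
  rewrite big_ltn //; apply: le_trans (ler_normD _ _) _.
  rewrite (eq_big_nat _ _ (F2 := D a b f)); last by move=> i /andP[Ki _]; rewrite tail_D_high.
  have -> : \sum_(K.+1 <= i < N) D a b f i =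
     \sum_(1 <= i < N) D a b f i - \sum_(1 <= i < K.+1) D a b f i.
    by rewrite (big_cat_nat (n := K.+1) (m := 1) (p := N)) //= addrAC subrr add0r.
  have := hK1 N K.+1 (leq_trans K1K (ltnW NK)) (leqW K1K).
  by move=> h; have := lerD DK h; lra.
exists K => N; apply: le_trans (_ : C * X ^+ 2 * N%:R <= _); last by rewrite ler_wpM2r.
apply: (hC _ gB X (ltW X0)) => // M; apply: le_trans (hq M) _.
by rewrite ler_sqr ?nnegrE ?ltW //; nra.
Qed.

Lemma sufficiency : has_limiting_distribution f.
Proof.
apply: (@levy_cauchy_limit _ (empirical_cdf f)) => [N x y xy|N x|N x|e x e0|e e0].
- rewrite !empirical_avg; apply: ler_avg => n; case: (leP (f n) x) => //= h.
  by rewrite (le_trans h).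
- by rewrite empirical_avg avg_ge0.
- rewrite empirical_avg; apply: avg_le => //.
  rewrite mul1r; apply: le_trans (_ : \sum_(m < N) 1 <= _).
    by apply: ler_sum => m _; case: (f m <= x); rewrite ?ler01.
  by rewrite sum_constr mulr1.
- have e20 : 0 < e / 2 by rewrite divr_gt0.
  (* Chebyshev at threshold e/2 then leaves a proportion e/4 of exceptional integers. Two such
     errors and e/4 from the truncated averages stay below e, and the two shifts by e/2 add up to
     e. *)
  have e4 : 0 < e / 4 * (e / 2) ^+ 2 by rewrite mulr_gt0 ?exprn_gt0 ?divr_gt0.
  have [K hK] := second_moment_tail e4.
  have cheb N : avg (fun n => (e / 2 < `|f n - low K n|)%R%:R) N <= e / 4.
    apply: le_trans (avg_chebyshev e20 (ltW e4) (hK N)) _.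
    by rewrite mulfK // gt_eqF // exprn_gt0.
  pose phi n : R := (low K n <= x + e / 2)%R%:R.
  have phiK : low_digits a b K phi.
    by move=> n k m Kn mn kmn; rewrite /phi truncate_high.
  have cphi := low_digits_avg_cvg b_gt0 le_ba phiK.
  have [N0 hN0] := cvgn_cauchy cphi (divr_gt0 e0 (ltr0Sn R 3)).
  exists N0 => N N' hN hN'; rewrite !empirical_avg.
  have h1 : avg (fun n => (f n <= x)%R%:R) N <=
      avg phi N + avg (fun n => (e / 2 < `|f n - low K n|)%R%:R) N.
    rewrite -avgD; apply: ler_avg => n; rewrite /phi.
    case: (leP (f n) x) => h /=; last by rewrite addr_ge0.
    case: (leP (low K n) _) => h' /=; first by rewrite lerDl.
    rewrite add0r; case: (ltP (e / 2)) => //=.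
    by rewrite ler_norml => /andP[] *; lra.
  have h2 : avg phi N' <= avg (fun n => (f n <= x + e)%R%:R) N' +
      avg (fun n => (e / 2 < `|f n - low K n|)%R%:R) N'.
    rewrite -avgD; apply: ler_avg => n; rewrite /phi.
    case: (leP (low K n) _) => h /=; last by rewrite addr_ge0.
    case: (leP (f n) _) => h' /=; first by rewrite lerDl.
    rewrite add0r; case: (ltP (e / 2)) => //=.
    by rewrite ler_norml => /andP[] *; lra.
  have := cheb N; have := cheb N'; have := hN0 N N' hN hN'.
  by rewrite ler_norml => /andP[_]; move: h1 h2; lra.
- have [C C0 hC] := second_moment_bounded.
  pose M := 1 + C / e.
  have Ce : 0 <= C / e by rewrite divr_ge0 // ltW.
  have M0 : 0 < M by rewrite /M; lra.
  have cheb N : avg (fun n => (M < `|f n|)%R%:R) N <= e.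
    apply: le_trans (avg_chebyshev M0 C0 (hC N)) _.
    rewrite ler_pdivrMr ?exprn_gt0 // mulrC -ler_pdivrMr // /M.
    by rewrite expr2; nra.
  (* The extra 1 turns f n <= -(M + 1) into the strict inequality M < |f n|. *)
  exists (M + 1), 1%N => N N1; rewrite !empirical_avg; split.
    apply: le_trans (cheb N); apply: ler_avg => n.
    case: (leP (f n) _) => h //=; case: (ltP M) => //=.
    by rewrite ler_norml => /andP[] *; lra.
  rewrite lerBlDr -[leLHS](avg_cst _ N1); apply: le_trans (lerD (lexx _) (cheb N)).
  rewrite -avgD; apply: ler_avg => n.
  case: (leP (f n) _) => h /=; first by rewrite lerDl.
  rewrite add0r; case: (ltP M) => //=.
  by rewrite ler_norml => /andP[] *; lra.
Qed.

End Sufficiency.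

(** * Weak convergence and integrals *)

Section CumulativeMeasure.
Variables (R : realType) (F : cumulativeBounded (0 : R) (1 : R)).
Local Notation P := (lebesgue_stieltjes_measure F).

Lemma cumulative_bounds x : 0 <= F x <= 1.
Proof.
have nd := cumulative_is_nondecreasing F.
apply/andP; split.
  rewrite -[leLHS](cvg_lim _ (@cumulativeNy _ _ _ F)) //.
  apply: limr_le; first by apply/cvg_ex; exists 0; exact: cumulativeNy.
  by near=> y; apply: nd; near: y; apply: nbhs_ninfty_le; rewrite num_real.
rewrite -[leRHS](cvg_lim _ (@cumulativey _ _ _ F)) //.
apply: limr_ge; first by apply/cvg_ex; exists 1; exact: cumulativey.
by near=> y; apply: nd; near: y; apply: nbhs_pinfty_ge; rewrite num_real.
Unshelve. all: end_near. Qed.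

Lemma ocitv_measure u v : u <= v -> P `]u, v]%classic = (F v - F u)%:E.
Proof.
move=> uv; rewrite /lebesgue_stieltjes_measure /measure_extension/=.
by rewrite measurable_mu_extE/=; [rewrite wlength_itv_bnd|exact: is_ocitv].
Qed.

(** A monotone function has countably many discontinuities in ]x, y[, which has positive Lebesgue
    measure. *)
Lemma continuity_point x y : x < y ->
  exists2 c, x < c < y & {for c, continuous F}.
Proof.
move=> xy; apply: contrapT => nc.
have nd := cumulative_is_nondecreasing F.
have cnt : countable `]x, y[%classic.
  apply: sub_countable (@discontinuity_countable _ x y F _); last first.
    by move=> u v _ _ ; exact: nd.
  apply: subset_card_le => c /= cxy; split=> //.
  have cl : cvg (F z @[z --> c^'-]).
    apply: nondecreasing_at_left_is_cvgr.
      by near=> z => u v _ _; exact: nd.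
    by near=> z; exists 1 => _ [u _ <-]; have /andP[] := cumulative_bounds u.
  have cr := cumulative_is_right_continuous F c.
  split=> //; first by apply/cvg_ex; exists (F c).
  rewrite (cvg_lim _ cr) //; apply/eqP => e; apply: nc; exists c.
    by move: cxy; rewrite in_itv.
  by apply/left_right_continuousP; split=> //; rewrite -e.
have := countable_lebesgue_measure0 cnt.
rewrite lebesgue_measure_itv /= lte_fin xy -EFinB => /eqP.
by rewrite eqe subr_eq0 gt_eqF.
Unshelve. all: end_near. Qed.

Lemma bounded_integrable (phi : R -> R) A : measurable A ->
  measurable_fun setT phi -> (exists B, forall x, `|phi x| <= B) ->
  P.-integrable A (EFin \o phi).
Proof.
move=> mA mphi [B hB]; apply: measurable_bounded_integrable => //.
- by apply: le_lt_trans (probability_le1 P mA) _; rewrite ltry.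
- exact: measurable_funTS.
- exists B; split; first by rewrite num_real.
  by move=> M BM x _ /=; apply: le_trans (hB x) (ltW BM).
Qed.

End CumulativeMeasure.

(* [I u v] is the integral of [phi] over ]u, v] with respect to [Phi] and [T] the
   integral over the whole line; abstracting them lets the lemma apply both to the
   Lebesgue-Stieltjes integral and to averages over {0, ..., N-1}. *)
Lemma riemann_stieltjes_dev (R : realType) (phi Phi : R -> R) (I : R -> R -> R)
    (T L eta : R) (x : nat -> R) (m : nat) :
  0 <= L -> nondecreasing Phi -> (forall u, 0 <= Phi u <= 1) ->
  I (x 0%N) (x 0%N) = 0 ->
  (forall u v w, u <= v -> v <= w -> I u w = I u v + I v w) ->
  (forall u v, u <= v ->
     `|I u v - phi u * (Phi v - Phi u)| <= L * (v - u) * (Phi v - Phi u)) ->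
  (forall i, x i <= x i.+1 <= x i + eta) ->
  (forall u v, u <= v -> `|T - I u v| <= 1 - (Phi v - Phi u)) ->
  `|T - \sum_(i < m) phi (x i) * (Phi (x i.+1) - Phi (x i))| <=
    L * eta + (1 - (Phi (x m) - Phi (x 0%N))).
Proof.
move=> L0 nd PB I0 Iadd Icell xstep IT.
have xm n : x 0%N <= x n.
  elim: n => // n IH; apply: le_trans IH _; by have /andP[] := xstep n.
have eta0 : 0 <= eta by have /andP[] := xstep 0%N; move=> h1 h2; lra.
have dev n : `|I (x 0%N) (x n) - \sum_(i < n) phi (x i) * (Phi (x i.+1) - Phi (x i))|
    <= L * eta * (Phi (x n) - Phi (x 0%N)).
  elim: n => [|n IH]; first by rewrite I0 big_ord0 !subrr normr0 mulr0.
  have /andP[h1 h2] := xstep n.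
  rewrite (Iadd _ _ _ (xm n) h1) big_ord_recr /= opprD addrACA.
  apply: le_trans (ler_normD _ _) _.
  have c := Icell _ _ h1; have dP := nd _ _ h1.
  have : L * (x n.+1 - x n) * (Phi (x n.+1) - Phi (x n)) <=
      L * eta * (Phi (x n.+1) - Phi (x n)).
    by rewrite ler_wpM2r ?subr_ge0 // ler_wpM2l //; lra.
  by move: (lerD IH c); lra.
rewrite -(subrKA (I (x 0%N) (x m))); apply: le_trans (ler_normD _ _) _.
rewrite addrC; apply: lerD; last exact: IT.
apply: le_trans (dev m) _; rewrite -[leRHS]mulr1 ler_wpM2l ?mulr_ge0 //.
by have /andP[_ h1] := PB (x m); have /andP[h2 _] := PB (x 0%N); lra.
Qed.

Section WeakConvergence.
Variables (R : realType) (f : nat -> R) (F : cumulativeBounded (0 : R) (1 : R)).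
Hypothesis fF : limiting_distribution f F.
Local Notation P := (lebesgue_stieltjes_measure F).

Lemma cumulative_grid eta e : 0 < eta -> 0 < e -> exists (x : nat -> R) m,
  [/\ forall i, {for x i, continuous F},
      forall i, x i <= x i.+1 <= x i + eta
    & 1 - (F (x m) - F (x 0%N)) <= e].
Proof.
move=> eta0 e0; have nd := cumulative_is_nondecreasing F.
have e2 : 0 < e / 2 by rewrite divr_gt0.
have h0 : 0 < eta / 2 by rewrite divr_gt0.
have [M0 hM0] : exists M, F M <= e / 2.
  have /cvgrPdist_le/(_ _ e2) := @cumulativeNy _ _ _ F.
  move=> /filter_ex[M hM]; exists M.
  by move: hM; rewrite sub0r normrN; apply: le_trans; exact: ler_norm.
have [M1 hM1] : exists M, 1 - e / 2 <= F M.
  have /cvgrPdist_le/(_ _ e2) := @cumulativey _ _ _ F.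
  move=> /filter_ex[M hM]; exists M.
  by move: hM; rewrite ler_norml => /andP[_]; lra.
(* One continuity point is chosen in each cell of width eta/2, so consecutive points are less than
   eta apart; starting at M0 - eta/2 puts the first one below M0. *)
pose A := M0 - eta / 2.
have Hx i : exists c, A + i%:R * (eta / 2) < c < A + i.+1%:R * (eta / 2) /\
    {for c, continuous F}.
  have [|c h1 h2] := @continuity_point _ F (A + i%:R * (eta / 2)) (A + i.+1%:R * (eta / 2)).
    by rewrite ltrD2l ltr_pM2r // ltr_nat.
  by exists c.
have [x hx] := choice Hx.
pose m := (Num.truncn (`|M1 - A| / (eta / 2))).+1.
exists x, m; split.
- by move=> i; have [] := hx i.
- move=> i; have [/andP[h1 h2] _] := hx i; have [/andP[h3 h4] _] := hx i.+1.
  have E1 : i.+1%:R = i%:R + 1 :> R by rewrite natr1.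
  have E2 : i.+2%:R = i%:R + 2 :> R by rewrite -natrD addn2.
  rewrite E1 in h2 h3; rewrite E2 in h4.
  by apply/andP; split; lra.
- have [/andP[_ h0'] _] := hx 0%N; have [/andP[hm _] _] := hx m.
  have u1 : F (x 0%N) <= F M0 by apply: nd; move: h0'; rewrite /A mul1r; lra.
  have u2 : F M1 <= F (x m).
    apply: nd; apply: le_trans (ltW hm).
    have : `|M1 - A| / (eta / 2) < m%:R by exact: truncnS_gt.
    rewrite ltr_pdivrMr // => /ltW; have := ler_norm (M1 - A); lra.
  lra.
Qed.

(** Integral and average are both compared with Riemann-Stieltjes sums over one grid. These sums
    involve finitely many continuity points of F, where convergence is known. *)
Lemma avg_cvg_integral (phi : R -> R) L : 0 <= L ->
  measurable_fun setT phi -> (forall x, `|phi x| <= 1) ->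
  (forall x y, `|phi x - phi y| <= L * `|x - y|) ->
  avg (phi \o f) N @[N --> \oo] --> \int[P]_x phi x.
Proof.
move=> L0 mphi phi1 phiL; apply/cvgrPdist_le => e e0.
pose eta := e / 8 / (L + 1).
pose FN N u : R := avg (fun n => (f n <= u)%R%:R) N.
have L1 : 0 < L + 1 by lra.
have eta0 : 0 < eta by rewrite !divr_gt0.
have Leta : L * eta <= e / 8.
  by rewrite /eta mulrCA ler_piMr ?divr_ge0 ?ltW // ltr_pdivrMr // mul1r; lra.
have [x [m [cx xstep hm]]] := cumulative_grid eta0 (divr_gt0 e0 (ltr0Sn R 7)).
have cE i : FN N (x i) @[N --> \oo] --> F (x i).
  have := fF (cx i); under [X in X @ _ --> _]eq_fun do rewrite empirical_avg. by [].
have integ A : measurable A -> P.-integrable A (EFin \o phi).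
  by move=> mA; apply: bounded_integrable => //; exists 1.
have nd := cumulative_is_nondecreasing F.
have devF : `|\int[P]_x phi x - \sum_(i < m) phi (x i) * (F (x i.+1) - F (x i))| <=
    L * eta + (1 - (F (x m) - F (x 0%N))).
  apply: (@riemann_stieltjes_dev _ phi F (fun u v => \int[P]_(y in `]u, v]) phi y)) => //.
  - by move=> u; exact: cumulative_bounds.
  - by rewrite set_itvoc0 Rintegral_set0.
  - move=> u v w uv vw; rewrite -Rintegral_setU //.
    + by rewrite -itv_bndbnd_setU.
    + by rewrite -itv_bndbnd_setU //; exact: integ.
    + apply/disj_set2P; rewrite predeqE => y; split=> // -[/=].
      rewrite !in_itv /= => /andP[_ h1] /andP[h2 _].
      by have := lt_le_trans h2 h1; rewrite ltxx.
  - move=> u v uv.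
    have -> : phi u * (F v - F u) = \int[P]_(y in `]u, v]) phi u.
      rewrite Rintegral_cst //; congr (_ * _).
      by rewrite -[LHS]/(fine (F v - F u)%:E) -ocitv_measure.
    have icst c : P.-integrable `]u, v] (EFin \o (fun=> c)).
      by apply: bounded_integrable => //; exists `|c|.
    rewrite -RintegralB //; last exact: integ.
    apply: le_trans (le_normr_Rintegral _ _) _ => //.
      apply: bounded_integrable => //; first exact: measurable_realfun.measurable_funB.
      exists 2 => y; apply: le_trans (ler_normB _ _) _.
      by rewrite (natrD _ 1 1) lerD.
    apply: le_trans (_ : \int[P]_(y in `]u, v]) (L * (v - u)) <= _).
      apply: le_Rintegral => //.
        apply: bounded_integrable => //.
          by apply: measurableT_comp => //; exact: measurable_realfun.measurable_funB.
        exists 2 => y; rewrite normr_id; apply: le_trans (ler_normB _ _) _.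
        by rewrite (natrD _ 1 1) lerD.
      move=> y /=; rewrite in_itv /= => /andP[uy yv].
      apply: le_trans (phiL _ _) _; rewrite ler_wpM2l // ger0_norm; lra.
    rewrite Rintegral_cst // le_eqVlt; apply/orP; left; apply/eqP; congr (_ * _).
    by rewrite -[RHS]/(fine (F v - F u)%:E) -ocitv_measure.
  - move=> u v uv.
    have E : \int[P]_y phi y = \int[P]_(y in `]u, v]) phi y + \int[P]_(y in ~` `]u, v]) phi y.
      rewrite -Rintegral_setU ?setUv //; first exact: measurableC.
        exact: integ.
      by apply/disj_set2P; rewrite setICr.
    rewrite E addrAC subrr add0r.
    have mC : measurable (~` `]u, v]%classic) by exact: measurableC.
    apply: le_trans (le_normr_Rintegral _ _) _ => //; first exact: integ.
    apply: le_trans (_ : \int[P]_(y in ~` `]u, v]) 1 <= _).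
      apply: le_Rintegral => //.
        apply: bounded_integrable => //; first exact: measurableT_comp.
        by exists 1 => y; rewrite normr_id.
      apply: bounded_integrable => //; exists 1 => y; by rewrite normr1.
    rewrite Rintegral_cst // mul1r.
    have PC := probability_setC P (measurable_itv `]u, v]).
    have PI : P `]u, v]%classic = (F v - F u)%:E := ocitv_measure F uv.
    rewrite le_eqVlt; apply/orP; left; apply/eqP.
    by rewrite -[RHS]/(fine (1 - (F v - F u)%:E)%E) -PI -PC.
have cS k : \sum_(i < k) phi (x i) * (FN N (x i.+1) - FN N (x i))
     @[N --> \oo] --> \sum_(i < k) phi (x i) * (F (x i.+1) - F (x i)).
  elim: k => [|k IH].
    by rewrite big_ord0; under eq_fun do rewrite big_ord0; exact: cvg_cst.
  rewrite big_ord_recr /=; under eq_fun do rewrite big_ord_recr /=.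
  by apply: cvgD => //; apply: cvgMr; apply: cvgB.
have cT : 1 - (FN N (x m) - FN N (x 0%N))
     @[N --> \oo] --> 1 - (F (x m) - F (x 0%N)).
  by apply: cvgB; [exact: cvg_cst | apply: cvgB].
have e8 : 0 < e / 8 by rewrite divr_gt0.
(* Error budget in units of e/8: two mesh errors, the mass of F outside the grid, the corresponding
   empirical mass (two units), and the difference of the sums, six units in all. *)
have fin (I S A S' d d' : R) : `|I - S| <= L * eta + d -> `|A - S'| <= L * eta + d' ->
    `|S - S'| <= e / 8 -> `|d - d'| <= e / 8 -> d <= e / 8 -> `|I - A| <= e.
  rewrite !ler_norml => /andP[? ?] /andP[? ?] /andP[? ?] /andP[? ?] ?.
  by apply/andP; split; lra.
near=> N.
have N0 : (0 < N)%N by near: N; exists 1%N.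
have nS : `|\sum_(i < m) phi (x i) * (F (x i.+1) - F (x i)) -
  \sum_(i < m) phi (x i) * (FN N (x i.+1) - FN N (x i))| <= e / 8.
  by near: N; exact: (cvgrPdist_le _ _).1 (cS m) _ e8.
have nT : `|1 - (F (x m) - F (x 0%N)) -
  (1 - (FN N (x m) - FN N (x 0%N)))| <= e / 8.
  by near: N; exact: (cvgrPdist_le _ _).1 cT _ e8.
have devN : `|avg (phi \o f) N - \sum_(i < m) phi (x i) *
    (FN N (x i.+1) - FN N (x i))| <=
    L * eta + (1 - (FN N (x m) - FN N (x 0%N))).
  have avgB (g h : nat -> R) : avg g N - avg h N = avg (fun n => g n - h n) N.
    by rewrite /avg -mulrBl -sumrB.
  have avgZ c (g : nat -> R) : c * avg g N = avg (fun n => c * g n) N.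
    by rewrite /avg mulrA mulr_sumr.
  have avgA (g : nat -> R) : `|avg g N| <= avg (fun n => `|g n|) N.
    rewrite /avg normrM normfV normr_nat ler_wpM2r ?invr_ge0 //; exact: ler_norm_sum.
  have cell u v n : u <= v -> (f n <= v)%R%:R - (f n <= u)%R%:R = (u < f n <= v)%R%:R :> R.
    move=> uv; case: (leP (f n) u) => h /=; last by rewrite subr0.
    by rewrite (le_trans h uv) subrr.
  apply: (@riemann_stieltjes_dev _ phi (FN N)
    (fun u v => avg (fun n => phi (f n) * (u < f n <= v)%R%:R) N)) => //.
  - move=> u v uv; apply: ler_avg => n; case: (leP (f n) u) => //= h.
    by rewrite (le_trans h uv).
  - move=> u; rewrite avg_ge0 //= -[leRHS](avg_cst _ N0); apply: ler_avg => n.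
    by case: (f n <= u); rewrite ?ler01.
  - rewrite /avg big1 ?mul0r // => n _.
    by case: (ltP (x 0%N) (f n)) => /= h; rewrite ?mulr0 // leNgt h mulr0.
  - move=> u v w uv vw; rewrite -avgD; congr (_ / _); apply: eq_bigr => n _.
    rewrite -mulrDr; congr (_ * _); rewrite -!cell //; last exact: le_trans vw.
    by ring.
  - move=> u v uv; rewrite !avgB !avgZ avgB.
    apply: le_trans (avgA _) _; apply: ler_avg => n; rewrite cell //.
    case: (boolP (u < f n <= v)) => [/andP[h1 h2]|_] /=; last by rewrite !mulr0 subrr normr0.
    rewrite !mulr1; apply: le_trans (phiL _ _) _; rewrite ler_wpM2l // ger0_norm; lra.
  - move=> u v uv; rewrite -[X in X - (_ - _)](avg_cst 1 N0) !avgB.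
    apply: le_trans (avgA _) _; apply: ler_avg => n; rewrite cell //.
    case: (boolP (u < f n <= v)) => _ /=; first by rewrite mulr1 !subrr normr0.
    by rewrite mulr0 !subr0 phi1.
exact: fin devF devN nS nT hm.
Unshelve. all: end_near. Qed.

End WeakConvergence.

(** * Trigonometric and complex estimates *)

Section Trigonometry.
Variable R : realType.
Implicit Types x y : R.

Lemma lipschitz_derive1 (h dh : R -> R) x y :
  (forall z : R, is_derive z (1 : R) h (dh z)) -> (forall z, `|dh z| <= 1) ->
  `|h x - h y| <= `|x - y|.
Proof.
move=> hd d1; wlog xy : x y / y <= x.
  by move=> wl; case: (leP y x) => [/wl //|/ltW/wl]; rewrite distrC [X in _ <= X]distrC.
have [|c _ ->] := @MVT_segment _ h dh y x xy (fun z _ => hd z).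
  apply: continuous_subspaceT => z.
  by apply/differentiable_continuous/derivable1_diffP; have [] := hd z.
by rewrite normrM ler_piMl.
Qed.

Lemma sin_lipschitz x y : `|sin x - sin y| <= `|x - y|.
Proof. by apply: (lipschitz_derive1 (dh := cos)) => z; exact: cos_max. Qed.

Lemma cos_lipschitz x y : `|cos x - cos y| <= `|x - y|.
Proof.
apply: (lipschitz_derive1 (dh := fun z => - sin z)) => z.
by rewrite normrN sin_max.
Qed.

Lemma sin_norm_le x : `|sin x| <= `|x|.
Proof. by have := sin_lipschitz x 0; rewrite sin0 !subr0. Qed.

Lemma cos_half x : 1 - cos x = 2 * sin (x / 2) ^+ 2.
Proof.
have {1}-> : x = (x / 2) *+ 2 by rewrite -[X in X *+ 2]mulr1 -mulrnAr; field.
by rewrite cos_mulr2n sin2cos2; ring.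
Qed.

Lemma cos_ge x : 1 - x ^+ 2 / 2 <= cos x.
Proof.
have h := sin_norm_le (x / 2); have e := cos_half x.
have : sin (x / 2) ^+ 2 <= (x / 2) ^+ 2.
  by rewrite -[leLHS]real_normK ?num_real // -[leRHS]real_normK ?num_real // ler_sqr ?nnegrE.
by move: e; lra.
Qed.

Lemma sin_norm_ge x : `|x| <= 1 / 2 -> `|x| / 2 <= `|sin x|.
Proof.
wlog x0 : x / 0 <= x.
  move=> wl; case: (leP 0 x) => [/wl //|/ltW x0 h].
  by have := wl (- x); rewrite oppr_ge0 sinN !normrN; apply.
move=> xh; rewrite ger0_norm // in xh *.
have [|c] := @MVT_segment _ sin cos 0 x x0 (fun z _ => is_derive_sin z).
  by apply: continuous_subspaceT; exact: continuous_sin.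
rewrite in_itv /= sin0 !subr0 => /andP[c0 cx] E.
apply: le_trans (ler_norm _); rewrite E mulrC ler_wpM2r //.
apply: le_trans (cos_ge c).
have : c ^+ 2 <= (1 / 2) ^+ 2 by rewrite ler_sqr ?nnegrE //; lra.
by lra.
Qed.

Lemma cos_le_quad x : `|x| <= 1 -> x ^+ 2 / 8 <= 1 - cos x.
Proof.
move=> x1; rewrite cos_half.
have h2 : `|x / 2| = `|x| / 2 by rewrite normrM normfV normr_nat.
have := @sin_norm_ge (x / 2); rewrite h2 => /(_ ltac:(lra)) h.
have : (`|x| / 2 / 2) ^+ 2 <= sin (x / 2) ^+ 2.
  by rewrite -[leRHS]real_normK ?num_real // ler_sqr ?nnegrE // !divr_ge0.
by rewrite !expr_div_n real_normK ?num_real //; lra.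
Qed.

End Trigonometry.

Section ComplexNorm.
Variable R : realType.
Implicit Types (z w : R[i]) (x y : R).

Lemma normc_ge0 z : 0 <= normc z.
Proof. by case: z => u v; exact: sqrtr_ge0. Qed.

Lemma normcC x : normc x%:C = `|x|.
Proof. by rewrite /= expr0n addr0 sqrtr_sqr. Qed.

Lemma normc_nat n : normc n%:R = n%:R :> R.
Proof. by have := normcC n%:R; rewrite rmorph_nat normr_nat. Qed.

Lemma normc_distC z w : normc (z - w) = normc (w - z).
Proof. by rewrite -opprB normcN. Qed.

Lemma normc_sum n (F : 'I_n -> R[i]) : normc (\sum_i F i) <= \sum_i normc (F i).
Proof.
elim/big_ind2: _ => //; first by rewrite ComplexField.Normc.normc0.
by move=> x1 x2 y1 y2 h1 h2; apply: le_trans (le_normcD _ _) (lerD h1 h2).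
Qed.

Lemma normc_sqr z : normc z ^+ 2 = complex.Re z ^+ 2 + complex.Im z ^+ 2.
Proof. by case: z => u v; rewrite /= sqr_sqrtr // addr_ge0 ?sqr_ge0. Qed.

Lemma Re_le_normc z : complex.Re z <= normc z.
Proof.
apply: le_trans (ler_norm _) _; rewrite -ler_sqr ?nnegrE ?normc_ge0 //.
by rewrite real_normK ?num_real // normc_sqr lerDl sqr_ge0.
Qed.

Lemma normc_le_ReIm z : normc z <= `|complex.Re z| + `|complex.Im z|.
Proof.
rewrite -ler_sqr ?nnegrE ?normc_ge0 ?addr_ge0 // normc_sqr sqrrD !real_normK ?num_real //.
by rewrite -addrA addrCA [leRHS]addrC -addrA lerD2l lerDl mulrn_wge0 // mulr_ge0.
Qed.

Lemma Re_sum n (F : 'I_n -> R[i]) : complex.Re (\sum_i F i) = \sum_i complex.Re (F i).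
Proof. by apply: (big_morph (fun z : R[i] => complex.Re z)) => // -[? ?] [? ?]. Qed.

Lemma Im_sum n (F : 'I_n -> R[i]) : complex.Im (\sum_i F i) = \sum_i complex.Im (F i).
Proof. by apply: (big_morph (fun z : R[i] => complex.Im z)) => // -[? ?] [? ?]. Qed.

Lemma expiD x y : expi (x + y) = expi x * expi y.
Proof.
by rewrite /expi sinD cosD; apply/eqP; rewrite eq_complex /= eqxx addrC eqxx.
Qed.

Lemma normc_expi x : normc (expi x) = 1.
Proof. by rewrite /= cos2Dsin2 sqrtr1. Qed.

Lemma expi0 : expi 0 = 1 :> R[i].
Proof. by rewrite /expi sin0 cos0. Qed.

Lemma normc_expi1_sqr x : normc (expi x - 1) ^+ 2 = 2 * (1 - cos x).
Proof.
rewrite normc_sqr /= subr0; have := cos2Dsin2 x.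
by move=> h; rewrite sqrrB1 -addrA [_ + sin x ^+ 2]addrC addrA; lra.
Qed.

Lemma normc_expiB x y : normc (expi x - expi y) = normc (expi (x - y) - 1).
Proof.
have -> : expi x - expi y = expi y * (expi (x - y) - 1).
  by rewrite mulrBr mulr1 -expiD [y + _]addrC subrK.
by rewrite ComplexField.Normc.normcM normc_expi mul1r.
Qed.

Lemma normc_expiB_le x y : normc (expi x - expi y) <= `|x - y|.
Proof.
rewrite normc_expiB -ler_sqr ?nnegrE ?normc_ge0 // normc_expi1_sqr real_normK ?num_real //.
by have := cos_ge (x - y); lra.
Qed.

Lemma normc_expi1_ge x : `|x| <= 1 -> x ^+ 2 / 4 <= normc (expi x - 1) ^+ 2.
Proof. by move=> /cos_le_quad h; rewrite normc_expi1_sqr; lra. Qed.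

(** Quantifies the defect in the triangle inequality: the projection of a unit vector w on u misses
    1 by half the squared distance. *)
Lemma unit_loss (w u : R[i]) : normc w = 1 -> normc u = 1 ->
  complex.Re (w * u^*) = 1 - normc (w - u) ^+ 2 / 2.
Proof.
have n2 z : normc z = 1 -> complex.Re z ^+ 2 + complex.Im z ^+ 2 = 1.
  by move=> h; rewrite -normc_sqr h expr1n.
move=> /n2 + /n2; case: w => p1 p2; case: u => q1 q2 h1 h2; rewrite normc_sqr /=.
move: h1 h2 => /= h1 h2.
have -> : (p1 - q1) ^+ 2 + (p2 - q2) ^+ 2 =
    (p1 ^+ 2 + p2 ^+ 2) + (q1 ^+ 2 + q2 ^+ 2) - 2 * (p1 * q1 + p2 * q2) by ring.
by rewrite h1 h2; lra.
Qed.

End ComplexNorm.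

(** * Tightness *)

Section Tightness.
Variables (R : realType) (f : nat -> R) (F : cumulativeBounded (0 : R) (1 : R)).
Hypothesis fF : limiting_distribution f F.

Lemma limiting_tight (e : R) : 0 < e -> exists2 M : R, 0 < M &
  forall N, avg (fun n => (M < `|f n|)%R%:R) N <= e.
Proof.
move=> e0; have e4 : 0 < e / 4 by rewrite divr_gt0.
have [x [m [cx xstep hm]]] := cumulative_grid F (ltr01) e4.
have c0 : avg (fun n => (f n <= x 0%N)%R%:R) N @[N --> \oo] --> F (x 0%N).
  by have := fF (cx 0%N); under [X in X @ _ --> _]eq_fun do rewrite empirical_avg.
have cm : avg (fun n => (f n <= x m)%R%:R) N @[N --> \oo] --> F (x m).
  by have := fF (cx m); under [X in X @ _ --> _]eq_fun do rewrite empirical_avg.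
have [N0 _ h0] := (cvgrPdist_le _ _).1 c0 _ e4.
have [N1 _ h1] := (cvgrPdist_le _ _).1 cm _ e4.
pose N2 := maxn N0 N1.
(* The sum covers the finitely many N below N2, for which no convergence is available: there the
   average is 0. *)
pose M := 1 + `|x 0%N| + `|x m| + \sum_(i < N2) `|f i|.
have S0 : 0 <= \sum_(i < N2) `|f i| by apply: sumr_ge0.
have a0 := normr_ge0 (x 0%N); have am := normr_ge0 (x m).
exists M; first by rewrite /M; lra.
move=> N; case: (ltnP N N2) => hN.
  rewrite /avg big1 ?mul0r ?ltW // => i _.
  case: ltP => //= ; rewrite ltNge; case/negP.
  have iN : (i < N2)%N by rewrite (ltn_trans _ hN).
  rewrite /M (bigD1 (Ordinal iN)) //=.
  have : 0 <= \sum_(j < N2 | j != Ordinal iN) `|f j| by apply: sumr_ge0.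
  by lra.
have N0N : (N0 <= N)%N by apply: leq_trans hN; exact: leq_maxl.
have N1N : (N1 <= N)%N by apply: leq_trans hN; exact: leq_maxr.
case: (posnP N) => [->|Npos]; first by rewrite /avg big_ord0 mul0r ltW.
have {}h0 := h0 _ N0N; have {}h1 := h1 _ N1N.
have : avg (fun n => (M < `|f n|)%R%:R) N + avg (fun n => (f n <= x m)%R%:R) N <=
   avg (fun n => (f n <= x 0%N)%R%:R) N + avg (fun=> 1) N :> R.
  rewrite -!avgD; apply: ler_avg => n.
  case: (leP (f n) (x m)) => hm'; case: (leP (f n) (x 0%N)) => h0' /=;
    case: (ltP M) => //= hM; rewrite ?(mulr0n, mulr1n); try lra.
  exfalso; move: hM; rewrite ltNge => /negP; apply.
  have k0 := ler_norm (- x 0%N); rewrite normrN in k0.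
  have k1 := ler_norm (x m).
  by rewrite ler_norml /M; apply/andP; split; lra.
rewrite avg_cst //; move: h0 h1 => /=; rewrite !ler_norml => /andP[? ?] /andP[? ?].
by lra.
Qed.

End Tightness.

(** * Necessity of the quadratic series *)

Lemma bounded_series_cvg (R : realType) (u : R^nat) B : (forall n, 0 <= u n) ->
  (forall N, \sum_(n < N) u n <= B) -> cvgn (fun N => \sum_(n < N) u n).
Proof.
move=> u0 uB; apply: nondecreasing_is_cvgn.
  apply/nondecreasing_seqP => n; by rewrite big_ord_recr /= lerDl.
by exists B => _ [n _ <-].
Qed.

Section EnergyNecessity.
Variables (R : realType) (a b : nat).
Hypotheses (b_gt0 : (0 < b)%N) (le_ba : (b <= a)%N).
Local Notation G := (Defs.G a b).
Local Notation al := (alpha R a b).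
Variables (f : nat -> R) (t : R).
Hypothesis fB : block_additive a b f.
Local Notation h n := (H a b f n t).

Lemma HSS n : h n.+2 = \sum_(k < a) expi (t * f (k * G n.+1)%N) * h n.+1 +
  \sum_(k < b) expi (t * f (a * G n.+1)%N) * expi (t * f (k * G n)%N) * h n.
Proof.
rewrite /H (sum_GSS_additive le_ba (fun x => expi (t * x)) n fB); congr (_ + _).
  apply: eq_bigr => k _; rewrite mulr_sumr; apply: eq_bigr => m _.
  by rewrite mulrDr expiD.
apply: eq_bigr => k _; rewrite mulr_sumr; apply: eq_bigr => m _.
by rewrite !mulrDr !expiD mulrA.
Qed.

Lemma normc_H_le n : normc (h n) <= (G n)%:R.
Proof.
apply: le_trans (normc_sum _) _; under eq_bigr do rewrite normc_expi.
by rewrite sum_constr mulr1.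
Qed.

Hypothesis hlow : forall n, (G n)%:R / 2 <= normc (h n).

Let nh n := normc (h n).
Let w n := h n / (nh n)%:C.

Let nh_gt0 n : 0 < nh n.
Proof. by apply: lt_le_trans (hlow n); rewrite divr_gt0 // Gr_gt0. Qed.

Let hE n : h n = (nh n)%:C * w n.
Proof.
by rewrite /w mulrC divfK // eq_complex /= negb_and gt_eqF ?nh_gt0.
Qed.

Let w1 n : normc (w n) = 1.
Proof.
rewrite /w ComplexField.Normc.normcM ComplexField.Normc.normcV normcC.
by rewrite (gtr0_norm (nh_gt0 n)) divff // gt_eqF //; exact: nh_gt0.
Qed.

(* Loss in the triangle inequality for the decomposition [HSS] of [h n.+2]. *)
Let loss n := a%:R * nh n.+1 + b%:R * nh n - nh n.+2.

Let Re_real (x : R) (z : R[i]) : complex.Re (x%:C * z) = x * complex.Re z.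
Proof. by case: z => u v /=; rewrite mul0r subr0. Qed.

Let loss_term (x : R) (e v u : R[i]) : normc e = 1 -> normc v = 1 -> normc u = 1 ->
  x - complex.Re (e * (x%:C * v) * u^*) = x * (normc (e * v - u) ^+ 2 / 2).
Proof.
move=> e1 v1 u1; have ev : normc (e * v) = 1 by rewrite ComplexField.Normc.normcM e1 v1 mulr1.
by rewrite mulrCA -mulrA Re_real (unit_loss ev u1); ring.
Qed.

Let lossE n : loss n =
  \sum_(k < a) nh n.+1 * (normc (expi (t * f (k * G n.+1)%N) * w n.+1 - w n.+2) ^+ 2 / 2) +
  \sum_(k < b) nh n * (normc (expi (t * f (a * G n.+1)%N) *
    expi (t * f (k * G n)%N) * w n - w n.+2) ^+ 2 / 2).
Proof.
have : nh n.+2 = complex.Re (h n.+2 * (w n.+2)^*).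
  rewrite hE -mulrA Re_real (unit_loss (w1 _) (w1 _)) subrr ComplexField.Normc.normc0.
  by rewrite expr0n /= mul0r subr0 mulr1.
have ReD (z z' : R[i]) : complex.Re (z + z') = complex.Re z + complex.Re z'.
  by case: z; case: z'.
rewrite /loss HSS mulrDl ReD !mulr_suml !Re_sum => ->.
rewrite opprD addrACA -!sum_constr -!sumrB; congr (_ + _); apply: eq_bigr => k _.
  by rewrite [h n.+1]hE loss_term ?normc_expi.
by rewrite [h n]hE loss_term // ComplexField.Normc.normcM !normc_expi mulr1.
Qed.

Let loss_ge0 n : 0 <= loss n.
Proof.
rewrite lossE; apply: addr_ge0; apply: sumr_ge0 => k _;
  by rewrite mulr_ge0 ?divr_ge0 ?sqr_ge0 // ltW.
Qed.

Let loss1 n k : (k < a)%N ->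
  nh n.+1 * (normc (expi (t * f (k * G n.+1)%N) * w n.+1 - w n.+2) ^+ 2 / 2) <= loss n.
Proof.
move=> ka; rewrite lossE (bigD1 (Ordinal ka)) //= -addrA lerDl.
apply: addr_ge0; apply: sumr_ge0 => j _;
  by rewrite mulr_ge0 ?divr_ge0 ?sqr_ge0 // ltW.
Qed.

Let loss2 n :
  nh n * (normc (expi (t * f (a * G n.+1)%N) * w n - w n.+2) ^+ 2 / 2) <= loss n.
Proof.
rewrite lossE (bigD1 (Ordinal b_gt0)) //= addrCA mul0n.
rewrite (block_additive0 fB) mulr0 expi0 mulr1 lerDl addr_ge0 //; apply: sumr_ge0 => j _;
  by rewrite mulr_ge0 ?divr_ge0 ?sqr_ge0 // ltW.
Qed.

Let al_gt0 : 0 < al := alpha_gt0 R b_gt0 le_ba.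
Let an n : 0 < al ^+ n. Proof. by rewrite exprn_gt0. Qed.
Let dl n := loss n / al ^+ n.+2.

Let dl_ge0 n : 0 <= dl n. Proof. by rewrite divr_ge0 // ltW. Qed.

Let nh_low n : al ^+ n / 2 <= nh n.
Proof.
apply: le_trans (hlow n); rewrite ler_pM2r ?invr_gt0 //; exact: G_gealpha.
Qed.

(** Since a / alpha = 1 - c with c = b / alpha^2, the normalised loss telescopes: it is the decrease
    of u_(n+1) + c u_n, where u_n = |H_n| / alpha^n. This quantity is nonnegative and starts at 2 +
    1 * 2 at most. *)
Let dl_sum N : \sum_(n < N) dl n <= 4.
Proof.
pose u n := nh n / al ^+ n.
have u2 n : 0 <= u n <= 2.
  apply/andP; split; first by rewrite divr_ge0 // ltW.
  rewrite ler_pdivrMr //; exact: le_trans (normc_H_le n) (G_lealpha R b_gt0 le_ba n).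
pose c := b%:R / al ^+ 2.
have c0 : 0 <= c by rewrite divr_ge0 // ltW.
have c1 : c <= 1.
  rewrite ler_pdivrMr // mul1r (alpha_root R) lerDr mulr_ge0 // ltW //.
have ac : a%:R / al = 1 - c.
  have bE : b%:R = al ^+ 2 - a%:R * al by rewrite alpha_root; ring.
  by rewrite /c bE; field; rewrite gt_eqF.
have E n : dl n = (u n.+1 + c * u n) - (u n.+2 + c * u n.+1).
  have -> : u n.+1 + c * u n - (u n.+2 + c * u n.+1) =
      (1 - c) * u n.+1 + c * u n - u n.+2 by ring.
  rewrite -ac /dl /loss /u /c !exprS; field.
  by rewrite gt_eqF //= gt_eqF.
have -> : \sum_(n < N) dl n = (u 1%N + c * u 0%N) - (u N.+1 + c * u N).
  elim: N => [|N IH]; first by rewrite big_ord0 subrr.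
  by rewrite big_ord_recr /= IH E; ring.
have /andP[h1 h2] := u2 1%N; have /andP[h3 h4] := u2 0%N.
have /andP[h5 _] := u2 N.+1; have /andP[h6 _] := u2 N.
have k1 : c * u 0%N <= 1 * 2 by rewrite ler_pM.
have k2 : 0 <= c * u N by rewrite mulr_ge0.
by lra.
Qed.

Let al1 : 1 <= al := alpha_ge1 R b_gt0 le_ba.

Let phase1 n k : (k < a)%N ->
  normc (expi (t * f (k * G n.+1)%N) * w n.+1 - w n.+2) ^+ 2 <= 4 * al ^+ 2 * dl n.
Proof.
move=> ka; have := loss1 n ka; have := nh_low n.+1.
set x := normc _ ^+ 2; have x0 : 0 <= x := sqr_ge0 _ => l1 l2.
have E : al ^+ n.+2 * dl n = loss n by rewrite mulrC divfK // gt_eqF.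
rewrite -(ler_pM2l (an n.+1)).
have : al ^+ n.+1 / 2 * (x / 2) <= loss n.
  by apply: le_trans l2; rewrite ler_wpM2r // divr_ge0.
have : al * loss n >= loss n by rewrite ler_peMl // loss_ge0.
by rewrite -E (exprS al n.+1); lra.
Qed.

Let phase2 n :
  normc (expi (t * f (a * G n.+1)%N) * w n - w n.+2) ^+ 2 <= 4 * al ^+ 2 * dl n.
Proof.
have := loss2 n; have := nh_low n.
set x := normc _ ^+ 2; have x0 : 0 <= x := sqr_ge0 _ => l1 l2.
have E : al ^+ n.+2 * dl n = loss n by rewrite mulrC divfK // gt_eqF.
rewrite -(ler_pM2l (an n)).
have : al ^+ n / 2 * (x / 2) <= loss n.
  by apply: le_trans l2; rewrite ler_wpM2r // divr_ge0.
by rewrite -E !(exprS al); lra.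
Qed.

Let phase0 n : normc (w n.+1 - w n.+2) ^+ 2 <= 4 * al ^+ 2 * dl n.
Proof.
have := @phase1 n 0%N (leq_trans b_gt0 le_ba).
by rewrite mul0n (block_additive0 fB) mulr0 expi0 mul1r.
Qed.

(** For k < a both the rotated and the plain [w n.+2] are close to [w n.+3]. For k = a only [w n.+1]
    occurs rotated in the decomposition, so the way back leads from [w n.+3] through [w n.+2]. The
    common unit factor then cancels. *)
Let digit_phase n k : (k <= a)%N ->
  normc (expi (t * f (k * G n.+2)%N) - 1) ^+ 2 <= 36 * al ^+ 2 * (dl n.+1 + dl n).
Proof.
have sq2 (x y z : R) c d : 0 <= x -> 0 <= y -> 0 <= z -> x ^+ 2 <= c -> y ^+ 2 <= c ->
    z ^+ 2 <= d -> (x + y + z) ^+ 2 <= 9 * c + 9 * d.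
  move=> x0 y0 z0 xc yc zd.
  have s1 := sqr_ge0 (x - y); have s2 := sqr_ge0 (x - z); have s3 := sqr_ge0 (y - z).
  by have := sqr_ge0 z; nra.
have wm n' (e : R[i]) : normc (e - 1) = normc (e * w n' - w n').
  have -> : e * w n' - w n' = (e - 1) * w n' by rewrite mulrBl mul1r.
  by rewrite ComplexField.Normc.normcM w1 mulr1.
have d0 := dl_ge0 n; have d1 := dl_ge0 n.+1.
have A0 : 0 <= al ^+ 2 := sqr_ge0 _.
rewrite leq_eqVlt => /orP[/eqP ->|ka].
  rewrite (wm n.+1).
  have tri : normc (expi (t * f (a * G n.+2)%N) * w n.+1 - w n.+1) <=
      normc (expi (t * f (a * G n.+2)%N) * w n.+1 - w n.+3) +
      normc (w n.+2 - w n.+3) + normc (w n.+1 - w n.+2).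
    rewrite -(subrKA (w n.+3)); apply: le_trans (le_normcD _ _) _.
    rewrite -addrA lerD2l -(subrKA (w n.+2)); apply: le_trans (le_normcD _ _) _.
    by rewrite lerD // normc_distC.
  have := sq2 _ _ _ _ _ (normc_ge0 _) (normc_ge0 _) (normc_ge0 _)
    (phase2 n.+1) (phase0 n.+1) (phase0 n).
  have : normc (expi (t * f (a * G n.+2)%N) * w n.+1 - w n.+1) ^+ 2 <=
      (normc (expi (t * f (a * G n.+2)%N) * w n.+1 - w n.+3) +
       normc (w n.+2 - w n.+3) + normc (w n.+1 - w n.+2)) ^+ 2.
    by rewrite ler_sqr ?nnegrE ?addr_ge0 ?normc_ge0.
  by lra.
rewrite (wm n.+2).
have tri : normc (expi (t * f (k * G n.+2)%N) * w n.+2 - w n.+2) <=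
    normc (expi (t * f (k * G n.+2)%N) * w n.+2 - w n.+3) + normc (w n.+2 - w n.+3) + 0.
  rewrite addr0 -(subrKA (w n.+3)); apply: le_trans (le_normcD _ _) _.
  by rewrite lerD2l normc_distC.
have z0 : (0 : R) ^+ 2 <= 0 by rewrite expr0n.
have := sq2 _ _ _ _ _ (normc_ge0 _) (normc_ge0 _) (lexx 0) (phase1 n.+1 ka) (phase0 n.+1) z0.
have : normc (expi (t * f (k * G n.+2)%N) * w n.+2 - w n.+2) ^+ 2 <=
    (normc (expi (t * f (k * G n.+2)%N) * w n.+2 - w n.+3) + normc (w n.+2 - w n.+3) + 0) ^+ 2.
  by rewrite ler_sqr ?nnegrE ?addr_ge0 ?normc_ge0.
by have := mulr_ge0 A0 d0; lra.
Qed.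

Lemma energy_necessity : t != 0 ->
  (forall n k, (k <= a)%N -> `|t * f (k * G n)%N| <= 1) ->
  cvgn (fun N => \sum_(n < N) digit_energy a b f n).
Proof.
(* 144 = 4 * 36: the 36 comes from [digit_phase], the 4 from [normc_expi1_ge]. *)
move=> t0 small; pose c := a%:R * (144 * al ^+ 2 / t ^+ 2).
have t2 : 0 < t ^+ 2 by rewrite exprn_even_gt0.
have A0 : 0 <= al ^+ 2 := sqr_ge0 _.
have C0 : 0 <= 144 * al ^+ 2 / t ^+ 2 by rewrite divr_ge0 ?ltW // mulr_gt0.
have c0 : 0 <= c by rewrite mulr_ge0.
have qle n : digit_energy a b f n.+2 <= c * (dl n.+1 + dl n).
  rewrite /digit_energy; apply: le_trans (_ : \sum_(1 <= k < a.+1)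
      (144 * al ^+ 2 / t ^+ 2) * (dl n.+1 + dl n) <= _).
    rewrite big_nat [leRHS]big_nat; apply: ler_sum => k /andP[_ ka].
    rewrite mulrAC ler_pdivlMr // mulrC -exprMn.
    have := digit_phase n ka; have := normc_expi1_ge (small n.+2 k ka).
    by lra.
  by rewrite sumr_const_nat subn1 /= -[X in X <= _]mulr_natl mulrA.
apply: (@bounded_series_cvg _ _ (digit_energy a b f 0 + digit_energy a b f 1 + c * 8)).
  by move=> n; exact: digit_energy_ge0.
have q0 := digit_energy_ge0 a b f.
have big N : \sum_(n < N.+2) digit_energy a b f n <=
    digit_energy a b f 0 + digit_energy a b f 1 + c * 8.
  rewrite 2!big_ord_recl /= addrA lerD2l.
  apply: le_trans (_ : \sum_(n < N) c * (dl n.+1 + dl n) <= _).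
    by apply: ler_sum => n _; exact: qle.
  rewrite -mulr_sumr ler_wpM2l // big_split /=.
  have := dl_sum N; have := dl_sum N.+1; rewrite big_ord_recl /=.
  by have := dl_ge0 0%N; under [X in dl 0 + X]eq_bigr do rewrite /bump /=; lra.
move=> N; apply: le_trans (big N); rewrite !big_ord_recr /= -addrA lerDl.
exact: addr_ge0.
Qed.

End EnergyNecessity.

(** * Necessity of the linear series *)

Section ComplexAverages.
Variable R : realType.
Implicit Types (z w : nat -> R[i]) (phi : nat -> R).

Definition cavg z N := (\sum_(m < N) z m) / N%:R.

Lemma complex_divn (x y : R) N : (x +i* y) / N%:R = (x / N%:R) +i* (y / N%:R).
Proof.
have -> : (N%:R : R[i])^-1 = (N%:R^-1)%:C by rewrite fmorphV rmorph_nat.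
by apply/eqP; rewrite eq_complex /= !mulr0 subr0 add0r !eqxx.
Qed.

Lemma cavgE z N : cavg z N =
  avg (fun m => complex.Re (z m)) N +i* avg (fun m => complex.Im (z m)) N.
Proof.
rewrite /cavg /avg -complex_divn -Re_sum -Im_sum; congr (_ / _).
by case: (\sum_(m < N) z m).
Qed.

Lemma cavg_expi phi N : cavg (fun m => expi (phi m)) N =
  avg (cos \o phi) N +i* avg (sin \o phi) N.
Proof. by rewrite cavgE. Qed.

Lemma normc_cavg_le z N : normc (cavg z N) <= avg (fun m => normc (z m)) N.
Proof.
rewrite /cavg ComplexField.Normc.normcM ComplexField.Normc.normcV normc_nat.
by rewrite /avg ler_wpM2r ?invr_ge0 // normc_sum.
Qed.

Lemma cavgB z w N : cavg z N - cavg w N = cavg (fun m => z m - w m) N.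
Proof. by rewrite /cavg -mulrBl -sumrB. Qed.

Lemma cavgM c z N : cavg z N * c = cavg (fun m => z m * c) N.
Proof. by rewrite /cavg mulrAC -mulr_suml. Qed.

Lemma avg_unit_le (phi : nat -> R) N : (forall n, phi n <= 1) -> avg phi N <= 1.
Proof.
move=> h; apply: avg_le => //; rewrite mul1r -[N%:R]mulr1 -sum_constr.
by apply: ler_sum.
Qed.

Lemma normc_cavg_expi phi N : normc (cavg (fun m => expi (phi m)) N) <= 1.
Proof.
by apply: le_trans (normc_cavg_le _ _) (avg_unit_le _ _) => n; rewrite normc_expi.
Qed.

Definition ccauchy z := forall e, 0 < e -> exists N, forall n m,
  (N <= n)%N -> (N <= m)%N -> normc (z n - z m) <= e.

Lemma ccauchy_ReIm (x y : R^nat) : cvgn x -> cvgn y -> ccauchy (fun n => x n +i* y n).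
Proof.
move=> cx cy e e0; have e2 : 0 < e / 2 by rewrite divr_gt0.
have [N1 h1] := cvgn_cauchy cx e2; have [N2 h2] := cvgn_cauchy cy e2.
exists (maxn N1 N2) => n m; rewrite !geq_max => /andP[n1 n2] /andP[m1 m2].
apply: le_trans (normc_le_ReIm _) _; rewrite /=.
by have := lerD (h1 n m n1 m1) (h2 n m n2 m2); lra.
Qed.

Lemma ccauchyM z w : (forall n, normc (z n) <= 1) -> (forall n, normc (w n) <= 1) ->
  ccauchy z -> ccauchy w -> ccauchy (fun n => z n * w n).
Proof.
move=> z1 w1 cz cw e e0; have e2 : 0 < e / 2 by rewrite divr_gt0.
have [N1 h1] := cz _ e2; have [N2 h2] := cw _ e2.
exists (maxn N1 N2) => n m; rewrite !geq_max => /andP[n1 n2] /andP[m1 m2].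
have -> : z n * w n - z m * w m = (z n - z m) * w n + z m * (w n - w m) by ring.
apply: le_trans (le_normcD _ _) _; rewrite !ComplexField.Normc.normcM.
have := ler_pM (normc_ge0 _) (normc_ge0 _) (h1 n m n1 m1) (w1 n).
have := ler_pM (normc_ge0 _) (normc_ge0 _) (z1 m) (h2 n m n2 m2).
by lra.
Qed.

Lemma ccauchy_expi (x : R^nat) c : cvgn x -> ccauchy (fun n => expi (c * x n)).
Proof.
move=> cx e e0; have [|N hN] := @cvgn_cauchy _ _ cx (e / (`|c| + 1)).
  by rewrite divr_gt0 // ltr_wpDl.
exists N => n m Nn Nm; apply: le_trans (normc_expiB_le _ _) _.
rewrite -mulrBr normrM; have := hN n m Nn Nm; rewrite ler_pdivlMr ?ltr_wpDl //.
by have := normr_ge0 (x n - x m); lra.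
Qed.

End ComplexAverages.

Section SubsequenceG.
Variables (R : realType) (a b : nat).
Hypotheses (b_gt0 : (0 < b)%N) (le_ba : (b <= a)%N).
Local Notation G := (Defs.G a b).

Lemma cvg_comp_G (u : R^nat) (l : R) : u N @[N --> \oo] --> l ->
  u (G n) @[n --> \oo] --> l.
Proof.
move=> /cvgrPdist_le ul; apply/cvgrPdist_le => e /ul[N _ hN]; exists N => // n /= Nn.
by apply: hN => /=; apply: leq_trans Nn (ltnW _); exact: ltn_G.
Qed.

Lemma is_cvg_comp_G (u : R^nat) : cvgn u -> cvgn (fun n => u (G n)).
Proof. by move=> /cvg_ex[l /cvg_comp_G ul]; apply/cvg_ex; exists l. Qed.

End SubsequenceG.

Section MeanNecessity.
Variables (R : realType) (a b : nat).
Hypotheses (b_gt0 : (0 < b)%N) (le_ba : (b <= a)%N).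
Local Notation G := (Defs.G a b).
Variables (f : nat -> R) (t : R).
Hypothesis fB : block_additive a b f.
Local Notation mu n := (block_mean a b f n).
Local Notation low K := (truncate_low a b f K).
Local Notation Phi n := (cavg (fun m => expi (t * f m)) (G n)).

Hypothesis cq : cvgn (fun N => \sum_(n < N) digit_energy a b f n).

(** After centring, only the variance of the tail matters, so the quadratic series alone suffices.
    The root mean square is at most 8 d; the AM-GM inequality with weight 16 d gives the same bound
    for the mean absolute deviation. *)
Lemma centred_truncation K d n : 0 < d ->
  (forall N, \sum_(i < N) digit_energy a b (fun n => f n - low K n) i <= d ^+ 2) ->
  normc (Phi n * expi (- t * mu n) -
    cavg (fun m => expi (t * low K m)) (G n) * expi (- t * avg (low K) (G n)))
  <= `|t| * (8 * d).
Proof.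
move=> d0 hd; set nu := avg _ _; pose dm := mu n - nu.
have Gn := Gr_gt0 R a b_gt0 n.
have muT : block_mean a b (fun n => f n - low K n) n = dm.
  by rewrite /dm /nu /block_mean /block_sum /avg -mulrBl -sumrB.
have gB := additive_tail b_gt0 le_ba K fB.
have := block_var_le b_gt0 le_ba gB n hd; rewrite /block_var muT => hV.
have -> : Phi n * expi (- t * mu n) = Phi n * expi (- (t * dm)) * expi (- t * nu).
  by rewrite -mulrA -expiD; congr (_ * expi _); rewrite /dm; ring.
rewrite -mulrBl ComplexField.Normc.normcM normc_expi mulr1.
rewrite cavgM cavgB; apply: le_trans (normc_cavg_le _ _) _.
apply: le_trans (_ : avg (fun m => `|t| * `|f m - low K m - dm|) (G n) <= _).
  apply: ler_avg => m; rewrite -expiD; apply: le_trans (normc_expiB_le _ _) _.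
  by rewrite -normrM le_eqVlt; apply/orP; left; apply/eqP; congr `|_|; ring.
rewrite /avg -mulr_sumr -mulrA ler_wpM2l // ler_pdivrMr //.
have amgm (x : R) : `|x| <= x ^+ 2 / (16 * d) + 4 * d.
  rewrite -[x ^+ 2]real_normK ?num_real // -lerBlDr ler_pdivlMr ?mulr_gt0 //.
  by have := sqr_ge0 (`|x| - 8 * d); lra.
apply: le_trans (_ : \sum_(m < G n) ((f m - low K m - dm) ^+ 2 / (16 * d) + 4 * d) <= _).
  by apply: ler_sum => m _; exact: amgm.
rewrite big_split /= sum_constr -mulr_suml.
have : (\sum_(m < G n) (f m - low K m - dm) ^+ 2) / (16 * d) <=
    (G n)%:R * (64 * d ^+ 2) / (16 * d).
  by rewrite ler_wpM2r // invr_ge0 mulr_ge0 // ltW.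
have -> : (G n)%:R * (64 * d ^+ 2) / (16 * d) = (G n)%:R * (4 * d).
  by field; rewrite gt_eqF.
by lra.
Qed.

(** Phi_n exp(-itmu_n) is nearly Cauchy by truncation, and Phi_n is Cauchy and bounded away from 0,
    so the phases exp(-itmu_n) are Cauchy. The bound |t (mu_n - mu_m)| <= 1 excludes winding and
    lets the means be recovered. *)
Lemma mean_necessity : t != 0 ->
  (forall n, 1 / 2 <= normc (Phi n)) ->
  ccauchy (fun n => Phi n) ->
  (forall n m, `|t * (mu n - mu m)| <= 1) ->
  cvgn (fun n => mu n).
Proof.
move=> t0 hlow cPhi hmu; have nt : 0 < `|t| by rewrite normr_gt0.
apply: cvgn_cauchyP => e e0.
(* Then E / 2 <= |t| (16 d + e / 8) = |t| e / 4, and the factor 2 lost in inverting the exponential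
   gives exactly e. *)
pose d := e / 128; have d0 : 0 < d by rewrite divr_gt0.
have [K hK] := tail_energy_small b_gt0 le_ba fB cq (exprn_gt0 2 d0).
have f0 := block_additive0 fB.
have lowK (psi : R -> R) : low_digits a b K (psi \o low K).
  by move=> n k m Kn mn kmn; rewrite /= truncate_high.
have cavgG (psi : R -> R) : cvgn (fun n => avg (psi \o low K) (G n)).
  exact: (is_cvg_comp_G b_gt0 le_ba (low_digits_avg_cvg b_gt0 le_ba (lowK psi))).
have cY : ccauchy (fun n => cavg (fun m => expi (t * low K m)) (G n) *
    expi (- t * avg (low K) (G n))).
  apply: ccauchyM.
  - by move=> n; exact: normc_cavg_expi.
  - by move=> n; rewrite normc_expi.
  - under [X in ccauchy X]eq_fun do rewrite cavg_expi.
    apply: ccauchy_ReIm; first exact: (cavgG (fun x => cos (t * x))).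
    exact: (cavgG (fun x => sin (t * x))).
  - by apply: ccauchy_expi; exact: (cavgG id).
have e1 : 0 < `|t| * e / 16 by rewrite divr_gt0 // mulr_gt0.
have [N1 h1] := cPhi _ e1; have [N2 h2] := cY _ e1.
exists (maxn N1 N2) => n nN; set m := maxn N1 N2 in nN *.
have m1 : (N1 <= m)%N by exact: leq_maxl.
have m2 : (N2 <= m)%N by exact: leq_maxr.
have {}h1 := h1 n m (leq_trans m1 nN) m1; have {}h2 := h2 n m (leq_trans m2 nN) m2.
have c1 := centred_truncation n d0 (hK K (leqnn K)).
have c2 := centred_truncation m d0 (hK K (leqnn K)).
move: h2 c1 c2; set Yn := cavg _ (G n) * _; set Ym := cavg _ (G m) * _ => h2 c1 c2.
pose E := normc (expi (- t * mu n) - expi (- t * mu m)).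
have E0 : 0 <= E := normc_ge0 _.
have EPhi : E / 2 <= `|t| * (8 * d) + `|t| * (8 * d) + `|t| * e / 16 + `|t| * e / 16.
  apply: le_trans (_ : normc (Phi n * (expi (- t * mu n) - expi (- t * mu m))) <= _).
    by rewrite ComplexField.Normc.normcM -/E; have := ler_wpM2r E0 (hlow n); lra.
  have -> : Phi n * (expi (- t * mu n) - expi (- t * mu m)) =
     (Phi n * expi (- t * mu n) - Yn) + (- (Phi m * expi (- t * mu m) - Ym)) +
     (Yn - Ym) + (- ((Phi n - Phi m) * expi (- t * mu m))) by ring.
  apply: le_trans (le_normcD _ _) (lerD _ _).
    apply: le_trans (le_normcD _ _) (lerD _ h2).
    apply: le_trans (le_normcD _ _) (lerD c1 _).
    by rewrite normcN.
  by rewrite normcN ComplexField.Normc.normcM normc_expi mulr1.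
have sq : (t * (mu n - mu m)) ^+ 2 / 4 <= E ^+ 2.
  rewrite /E normc_expiB.
  have -> : - t * mu n - - t * mu m = - (t * (mu n - mu m)) by ring.
  by have := @normc_expi1_ge _ (- (t * (mu n - mu m))); rewrite normrN sqrrN; apply.
have : `|t| * `|mu n - mu m| <= 2 * E.
  rewrite -normrM -ler_sqr ?nnegrE ?mulr_ge0 // real_normK ?num_real //.
  by move: sq; lra.
move: EPhi; rewrite /d => EPhi h3; rewrite -(ler_pM2l nt); lra.
Qed.

End MeanNecessity.

(** * The characteristic function *)

Section TightConsequences.
Variables (R : realType) (a b : nat).
Hypotheses (b_gt0 : (0 < b)%N) (le_ba : (b <= a)%N).
Local Notation G := (Defs.G a b).
Variables (f : nat -> R) (M e : R).
Hypothesis fB : block_additive a b f.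
Hypothesis M_gt0 : 0 < M.
Hypothesis tight : forall N, avg (fun n => (M < `|f n|)%R%:R) N <= e.

Let bad m : R := (M < `|f m|)%R%:R.

Let sum_bad N : (0 < N)%N -> \sum_(m < N) bad m <= e * N%:R.
Proof. by move=> N0; rewrite -ler_pdivrMr ?ltr0n //; exact: tight. Qed.

(** If |f(kG_n)| > 2 M, then for each m < p one of f(m), f(kG_n + m) exceeds M in absolute value. So
    the p pairs contain at least p bad integers, whereas tightness allows at most e p + e (a+1)^2
    p. *)
Let digit_block_bounded n k p : e * (a.+1%:R ^+ 2 + 1) < 1 ->
  (0 < p)%N -> (p <= G n)%N -> (forall m, (m < p)%N -> (k * G n + m < G n.+1)%N) ->
  (G n.+1 <= a.+1 ^ 2 * p)%N -> `|f (k * G n)%N| <= 2 * M.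
Proof.
move=> he p0 pG kpG GSp; rewrite leNgt; apply/negP => big_f.
have p1 : 0 < p%:R :> R by rewrite ltr0n.
have kGp : (k * G n + p <= G n.+1)%N.
  by have := kpG p.-1; rewrite prednK // leqnn -addnS prednK // => /(_ isT).
have GS0 : (0 < G n.+1)%N by exact: G_gt0.
have e0 : 0 <= e by apply: le_trans (tight 0); rewrite /avg big_ord0 mul0r.
have S2 : \sum_(m < p) bad (k * G n + m)%N <= e * (a.+1 ^ 2 * p)%:R.
  apply: le_trans (_ : \sum_(m < G n.+1) bad m <= _).
    rewrite -(subnKC kGp) !big_split_ord /= -addrA addrCA lerDl addr_ge0 //; exact: sumr_ge0.
  by apply: le_trans (sum_bad GS0) _; rewrite ler_wpM2l // ler_nat.
have : p%:R <= \sum_(m < p) bad m + \sum_(m < p) bad (k * G n + m)%N.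
  rewrite -big_split /= -[p%:R]mulr1 -sum_constr; apply: ler_sum => m _.
  rewrite /bad fB ?kpG ?(leq_trans (ltn_ord m)) //.
  case: (ltP M) => h1 /=; first by rewrite lerDl.
  case: (ltP M) => h2 /=; first by rewrite add0r.
  exfalso; have := ler_normB (f (k * G n)%N + f m) (f m); rewrite addrK; lra.
have := sum_bad p0; rewrite natrM natrX in S2.
move=> h1 h2; have : (e * (a.+1%:R ^+ 2 + 1)) * p%:R < 1 * p%:R by rewrite ltr_pM2r.
by lra.
Qed.

(** Below the top digit a full subblock is available. After the digit a only a length G_(n-1) is
    guaranteed, two levels below G_(n+1); this is where (a+1)^2 comes from. *)
Lemma tight_digit_bounded n k : e * (a.+1%:R ^+ 2 + 1) < 1 ->
  (k <= a)%N -> `|f (k * G n)%N| <= 2 * M.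
Proof.
move=> he; rewrite leq_eqVlt => /orP[/eqP ->|ka].
  case: n => [|n].
    apply: (digit_block_bounded (p := 1) he) => //.
      by case=> // _; rewrite addn0 ltn_kG.
    by rewrite muln1 -[X in (X <= _)%N]expn1 leq_exp2l // ltnS (leq_trans b_gt0).
  apply: (digit_block_bounded (p := G n) he); rewrite ?G_gt0 //.
  - by rewrite ltnW // ltn_GS.
  - by move=> m mG; have := ltn_topblock b_gt0 mG; rewrite mul0n.
  - apply: leq_trans (leq_GS le_ba _) _.
    by rewrite expnS expn1 -mulnA leq_mul2l leq_GS.
apply: (digit_block_bounded (p := G n) he); rewrite ?G_gt0 //.
  by move=> m mG; exact: ltn_block.
by apply: leq_trans (leq_GS le_ba _) _; rewrite leq_mul2r leq_pmulr ?orbT.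
Qed.

(** cos >= 7/8 where |t f| <= 1/2, and -1 = 7/8 - 15/8 bounds it on the bad set, of density at most
    1/8; thus 7/8 - 15/64 > 1/2 remains. *)
Lemma tight_H_low t n : e <= 1 / 8 -> `|t| * M <= 1 / 2 ->
  (G n)%:R / 2 <= normc (H a b f n t).
Proof.
move=> e8 tM; apply: le_trans (Re_le_normc _); rewrite /H Re_sum /=.
apply: le_trans (_ : \sum_(m < G n) (7 / 8 - 15 / 8 * bad m) <= _).
  rewrite sumrB sum_constr -mulr_sumr.
  have := sum_bad (G_gt0 a b_gt0 n); have := Gr_gt0 R a b_gt0 n.
  by nra.
apply: ler_sum => m _; rewrite /bad; case: (ltP M) => h /=.
  by have := cos_geN1 (t * f m); lra.
rewrite mulr0 subr0; apply: le_trans (cos_ge _).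
have : `|t * f m| <= 1 / 2.
  by rewrite normrM; apply: le_trans tM; rewrite ler_wpM2l.
rewrite -[(t * f m) ^+ 2]real_normK ?num_real //; set x := `|_| => hx.
have x0 : 0 <= x by rewrite /x.
by nra.
Qed.

(** On the good set, of density at least 7/8, mu^2 <= 2 f^2 + 2 (f - mu)^2; averaging uses |f| <= M
    and the variance bound 64 Q. *)
Lemma tight_mean_bounded Q n : e <= 1 / 8 ->
  (forall N, \sum_(i < N) digit_energy a b f i <= Q) ->
  block_mean a b f n ^+ 2 <= 8 / 7 * (2 * M ^+ 2 + 128 * Q).
Proof.
move=> e8 hQ; set mu := block_mean a b f n.
have Gn := Gr_gt0 R a b_gt0 n.
have hV : \sum_(m < G n) (f m - mu) ^+ 2 <= (G n)%:R * (64 * Q).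
  exact: (block_var_le b_gt0 le_ba fB n hQ).
have : \sum_(m < G n) mu ^+ 2 <=
    \sum_(m < G n) (2 * M ^+ 2 + 2 * (f m - mu) ^+ 2 + mu ^+ 2 * bad m).
  apply: ler_sum => m _; rewrite /bad; case: (ltP M) => h /=.
    by rewrite mulr1 lerDr addr_ge0 // mulr_ge0 ?sqr_ge0.
  have fM : f m ^+ 2 <= M ^+ 2.
    by rewrite -[leLHS]real_normK ?num_real // ler_sqr ?nnegrE // ltW.
  by have := sqr_ge0 (2 * f m - mu); nra.
rewrite !big_split /= !sum_constr -!mulr_sumr => h.
have sb : \sum_(m < G n) bad m <= 1 / 8 * (G n)%:R.
  by apply: le_trans (sum_bad (G_gt0 a b_gt0 n)) _; rewrite ler_wpM2r // ltW.
have m2 : 0 <= mu ^+ 2 := sqr_ge0 _.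
have hh := ler_wpM2l m2 sb.
by rewrite -(ler_pM2l Gn); lra.
Qed.

End TightConsequences.

Section CharacteristicFunction.
Variables (R : realType) (a b : nat).
Hypotheses (b_gt0 : (0 < b)%N) (le_ba : (b <= a)%N).
Local Notation G := (Defs.G a b).
Variables (f : nat -> R) (F : cumulativeBounded (0 : R) (1 : R)).
Hypothesis fF : limiting_distribution f F.

Lemma avg_trig_cvg t :
  avg (fun m => cos (t * f m)) N @[N --> \oo] -->
    \int[lebesgue_stieltjes_measure F]_x cos (t * x) /\
  avg (fun m => sin (t * f m)) N @[N --> \oo] -->
    \int[lebesgue_stieltjes_measure F]_x sin (t * x).
Proof.
have ct : continuous (fun x : R => t * x) by move=> x; apply: cvgMr; exact: cvg_id.
have mt : measurable_fun setT (fun x : R => t * x).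
  exact: measurable_realfun.continuous_measurable_fun.
have lt (h : R -> R) : (forall x y : R, `|h x - h y| <= `|x - y|) ->
    forall x y, `|h (t * x) - h (t * y)| <= `|t| * `|x - y|.
  by move=> hl x y; rewrite -normrM mulrBr.
split.
  apply: (avg_cvg_integral fF (phi := fun x => cos (t * x)) (normr_ge0 t)) => [|x|].
  - apply: (measurableT_comp (f := cos)) mt.
    by apply: measurable_realfun.continuous_measurable_fun; exact: continuous_cos.
  - exact: cos_max.
  - by move=> x y; apply: (lt cos (@cos_lipschitz R)).
apply: (avg_cvg_integral fF (phi := fun x => sin (t * x)) (normr_ge0 t)) => [|x|].
- apply: (measurableT_comp (f := sin)) mt.
  by apply: measurable_realfun.continuous_measurable_fun; exact: continuous_sin.
- exact: sin_max.
- by move=> x y; apply: (lt sin (@sin_lipschitz R)).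
Qed.

Lemma complex_cvg (x y : R^nat) (l m : R) :
  x n @[n --> \oo] --> l -> y n @[n --> \oo] --> m ->
  ((fun n => x n +i* y n) : nat -> R[i]^o) n @[n --> \oo] --> (l +i* m : R[i]^o).
Proof.
move=> /cvgrPdist_le xl /cvgrPdist_le ym; apply/cvgrPdist_le => -[e e'].
(* A positive radius in [R[i]] has zero imaginary part, so it may be taken real. *)
rewrite ltcE /= => /andP[/eqP -> e0].
have e2 : 0 < e / 2 by rewrite divr_gt0.
have [N1 _ h1] := xl _ e2; have [N2 _ h2] := ym _ e2.
exists (maxn N1 N2) => // n /=; rewrite geq_max => /andP[n1 n2].
change (`|(l +i* m) - (x n +i* y n) : R[i]| <= e%:C).
rewrite -[`|_|]/((normc ((l +i* m) - (x n +i* y n)))%:C) lecR.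
apply: le_trans (normc_le_ReIm _) _; rewrite /=.
by have := lerD (h1 n n1) (h2 n n2) => /=; lra.
Qed.

Lemma H_cvg t :
  ((fun n => H a b f n t / ((alpha R a b) ^+ n)%:C) : nat -> R[i]^o) n @[n --> \oo] -->
  ((kappa R a b)%:C * char_fun F t : R[i]^o).
Proof.
have [cc cs] := avg_trig_cvg t.
have cG := @G_alpha_cvg R a b b_gt0 le_ba.
have al0 := alpha_gt0 R b_gt0 le_ba.
have -> : (fun n => H a b f n t / ((alpha R a b) ^+ n)%:C) =
  (fun n => ((G n)%:R / alpha R a b ^+ n * avg (fun m => cos (t * f m)) (G n)) +i*
            ((G n)%:R / alpha R a b ^+ n * avg (fun m => sin (t * f m)) (G n))).
  apply/funext => n.
  have -> : H a b f n t = (G n)%:R * cavg (fun m => expi (t * f m)) (G n).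
    by rewrite /cavg mulrC divfK // pnatr_eq0 -lt0n G_gt0.
  have -> : ((alpha R a b ^+ n)%:C)^-1 = (alpha R a b ^+ n)^-1%:C by rewrite fmorphV.
  have -> : (G n)%:R = ((G n)%:R)%:C :> R[i] by rewrite rmorph_nat.
  rewrite cavg_expi; apply/eqP; rewrite eq_complex /=.
  by apply/andP; split; apply/eqP; rewrite /comp; ring.
have -> : (kappa R a b)%:C * char_fun F t =
  (kappa R a b * \int[lebesgue_stieltjes_measure F]_x cos (t * x)) +i*
  (kappa R a b * \int[lebesgue_stieltjes_measure F]_x sin (t * x)).
  by apply/eqP; rewrite eq_complex /= !mul0r subr0 addr0 !eqxx.
by apply: complex_cvg; apply: cvgM => //; exact: cvg_comp_G.
Qed.

Lemma prod_ratio_H t N : f 0%N = 0 -> (forall n, H a b f n t != 0) ->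
  \prod_(1 <= n < N.+1) (r a b f n t / (alpha R a b)%:C) =
  H a b f N t / ((alpha R a b) ^+ N)%:C.
Proof.
move=> f0 H0; have al0 : (alpha R a b)%:C != 0.
  apply/eqP => /(congr1 (@complex.Re R)) /= E.
  by have := alpha_gt0 R b_gt0 le_ba; rewrite E ltxx.
elim: N => [|N IH].
  rewrite big_geq // /H big_ord_recl big_ord0 addr0 f0 mulr0 expi0 expr0.
  by rewrite invr1 mulr1.
rewrite big_nat_recr //= IH /r /= !rmorphXn /= exprS.
by field; rewrite H0 expf_neq0 ?al0.
Qed.

End CharacteristicFunction.

Theorem theorem3p1 (R : realType) (a b : nat)
    (b_ge1 : (1 <= b)%N) (b_le_a : (b <= a)%N)
    (f : nat -> R) (f_additive : G_additive a b f) :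
  [/\ (has_limiting_distribution f <->
        cvgn (fun N : nat => \sum_(1 <= n < N) D a b f n) /\
        cvgn (fun N : nat =>
          \sum_(0 <= n < N) \sum_(1 <= k < a.+1) f (k * G a b n)%N ^+ 2)),
      (G a b n)%:R / alpha R a b ^+ n @[n --> \oo] --> kappa R a b
    & forall F : cumulativeBounded (0 : R) (1 : R),
        limiting_distribution f F ->
        exists t0 : R, 0 < t0 /\
          forall t : R, `|t| <= t0 ->
            (forall n : nat, H a b f n t != 0) /\
            let P : nat -> R[i]^o := fun N =>
              \prod_(1 <= n < N.+1) (r a b f n t / (alpha R a b)%:C) in
            cvgn P /\ char_fun F t = ((kappa R a b)%:C)^-1 * limn P].
Proof.
have fB := G_additive_block b_ge1 b_le_a f_additive.
have sqE : (fun N : nat => \sum_(0 <= n < N) \sum_(1 <= k < a.+1) f (k * G a b n)%N ^+ 2)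
    = (fun N => \sum_(n < N) digit_energy a b f n).
  by apply/funext => N; rewrite big_mkord.
have Gn n := Gr_gt0 R a b_ge1 n.
(* Small enough both for [tight_digit_bounded] and for the density 1/8 in [tight_H_low]. *)
pose e : R := 1 / (a.+1%:R ^+ 2 + 8).
have a20 : 1 <= a.+1%:R ^+ 2 :> R by rewrite exprn_ege1 // ler1n.
have e0 : 0 < e by rewrite divr_gt0 //; lra.
have e8 : e <= 1 / 8 by rewrite /e ler_pdivrMr; lra.
have ea : e * (a.+1%:R ^+ 2 + 1) < 1.
  by rewrite /e mulrAC mul1r ltr_pdivrMr ?mul1r; lra.
have low F : limiting_distribution f F -> exists2 M : R, 0 < M &
    forall N, avg (fun n => (M < `|f n|)%R%:R) N <= e.
  by move=> fF; exact: (limiting_tight fF e0).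
split; last first.
- move=> F fF; have [M M0 hM] := low F fF.
  have t00 : 0 < (2 * M)^-1 by rewrite invr_gt0 mulr_gt0.
  exists (2 * M)^-1; split=> // t ht.
  have Hne n : H a b f n t != 0.
    apply/eqP => H0; have tM : `|t| * M <= 1 / 2.
      by have := ler_wpM2r (ltW M0) ht; rewrite invfM mulfVK ?gt_eqF // mul1r.
    have := tight_H_low a b_ge1 hM n e8 tM.
    by rewrite H0 ComplexField.Normc.normc0; have := Gn n; lra.
  split=> // P.
  have cP : P n @[n --> \oo] --> ((kappa R a b)%:C * char_fun F t : R[i]^o).
    have -> : P = (fun n => H a b f n t / ((alpha R a b) ^+ n)%:C).
      by apply/funext => N; rewrite /P prod_ratio_H //; case: f_additive.
    exact: H_cvg.
  split; first by apply/cvg_ex; eexists; exact: cP.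
  have -> : limn P = (kappa R a b)%:C * char_fun F t.
    by apply: cvg_lim cP; exact: norm_hausdorff.
  rewrite mulKf //.
  apply/eqP => /(congr1 (@complex.Re R)) /= E.
  by have := kappa_gt0 R b_ge1 b_le_a; rewrite E ltxx.
- exact: G_alpha_cvg.
- rewrite sqE; split; last by case=> cD cq; exact: (sufficiency b_ge1 b_le_a fB cq cD).
  move=> [F fF]; have [M M0 hM] := low F fF.
  have fM n k : (k <= a)%N -> `|f (k * G a b n)%N| <= 2 * M.
    by move=> ka; apply: (tight_digit_bounded b_ge1 b_le_a fB hM).
  have t1 : (2 * M)^-1 != 0 by rewrite invr_eq0 mulf_neq0 // gt_eqF.
  have nt1 : `|(2 * M)^-1| = (2 * M)^-1 by rewrite ger0_norm // invr_ge0 mulr_ge0 // ltW.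
  have M2 : (2 * M)^-1 * (2 * M) = 1 by rewrite mulVf // mulf_neq0 // gt_eqF.
  have cq : cvgn (fun N => \sum_(n < N) digit_energy a b f n).
    apply: (energy_necessity b_ge1 b_le_a fB (t := (2 * M)^-1)) => // [n|n k ka].
      by apply: (tight_H_low a b_ge1 hM n e8); rewrite nt1; lra.
    by rewrite normrM nt1 -[leRHS]M2 ler_wpM2l ?fM // invr_ge0 mulr_ge0 // ltW.
  split=> //; have [Q Q0 hQ] := cvgn_bounded cq.
  have {}hQ N : \sum_(n < N) digit_energy a b f n <= Q by apply: le_trans (ler_norm _) (hQ N).
  (* Adding 1 avoids a square root: x^2 <= B - 1 implies x <= B. *)
  pose B : R := 1 + 8 / 7 * (2 * M ^+ 2 + 128 * Q).
  have B1 : 1 <= B by rewrite /B; have := sqr_ge0 M; lra.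
  have muB n : `|block_mean a b f n| <= B.
    have := tight_mean_bounded b_ge1 b_le_a fB M0 hM n e8 hQ.
    rewrite -real_normK ?num_real // /B; set x := `|_| => hx; nra.
  (* A smaller t than before: t M <= 1/2 keeps H_n away from 0, and 2 t B <= 1 rules out winding of
     the phases of the means. *)
  pose t := (2 * (M + B))^-1.
  have MB : 0 < 2 * (M + B) by lra.
  have t0 : 0 < t by rewrite invr_gt0.
  have tMB : t * (2 * (M + B)) = 1 by rewrite mulVf // gt_eqF.
  apply: (D_sum_cvg b_ge1 b_le_a fB fM).
  apply: (mean_necessity b_ge1 b_le_a fB cq (t := t)).
  + by rewrite gt_eqF.
  + move=> n; have tM : `|t| * M <= 1 / 2 by rewrite gtr0_norm //; nra.
    have := tight_H_low a b_ge1 hM n e8 tM.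
    rewrite /cavg ComplexField.Normc.normcM ComplexField.Normc.normcV normc_nat.
    by rewrite ler_pdivlMr // mulrAC mul1r.
  + have [cc cs] := avg_trig_cvg fF t.
    under [X in ccauchy X]eq_fun do rewrite cavg_expi.
    apply: ccauchy_ReIm; apply: is_cvg_comp_G => //; apply/cvg_ex; eexists.
      exact: cc.
    exact: cs.
  + move=> n m; rewrite normrM (gtr0_norm t0) -[leRHS]tMB; apply: ler_wpM2l; first exact: ltW.
    apply: le_trans (ler_normB _ _) _; have := muB n; have := muB m; lra.
Qed.
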